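(* Let $K$ be any alternating link (oriented and non-split) with symmetrized Alexander polynomial $\Delta_K$ and signature $\sigma(K)$, and let $P_K$ be the polynomial defined in the context. Then $$\Delta_K(t)=(-t)^{-\sigma(K)/2}P_K(-t,1,-t,1),$$ $$\Delta_K(t)=(-t)^{-\sigma(K)/2}P_K(1,-t,1,-t),\text{ and}$$ $$\Delta_K(t)=P_K(t^{-1/2},-t^{1/2},t^{-1/2},-t^{1/2}).$$
   Context: All links are oriented and non-split. A link is alternating if it has a diagram in which crossings are met alternately at over- and underpasses when the link is traversed (an alternating diagram). Crossing signs: rotate the picture so both strands point upward; the crossing is positive if the overstrand runs from lower left to upper right, negative if it runs from lower right to upper left. Regions of a diagram $D\subset\mathbb{R}^2$ are the components of the complement of the underlying 4-valent plane graph. Alexander polynomial and signature. The symmetrized Alexander polynomial $\Delta_K(t)\in\mathbb{Z}[t^{1/2},t^{-1/2}]$ is given by Kauffman's state sum: take any diagram of $K$ and fix two regions sharing a boundary edge. A state chooses one of the four corners at each crossing so that every region other than the two fixed ones contains exactly one chosen corner. With both strands at a crossing pointing upward, the left and right corners have weight $1$; the top corner has weight $t^{1/2}$ and the bottom corner $-t^{-1/2}$ at a positive crossing; the top corner has weight $t^{-1/2}$ and the bottom corner $-t^{1/2}$ at a negative crossing. Then $\Delta_K(t)$ is the sum over all states of the product of the weights of the chosen corners. It satisfies $\Delta_K(t)=\Delta_K(t^{-1})$. As is standard, the Alexander polynomial is considered as defined up to multiplication by a unit of $\mathbb{Z}[t^{1/2},t^{-1/2}]$. The signature $\sigma(K)$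 is the signature of $V+V^{\top}$ for a Seifert matrix $V$ of $K$, with the convention that the trefoil with positive crossings has signature $-2$. Tait digraph. Let $D\subset\mathbb{R}^2$ be an alternating diagram of a link. Choose the checkerboard shading of the regions such that at every crossing, when the picture is rotated so that the overstrand runs from lower left to upper right, the top and bottom regions are the shaded ones. The Tait digraph $G=(V,E)$ is the plane digraph with one vertex in each shaded region and one edge through each crossing, joining the vertices of the two shaded regions at that crossing (loops and multiple edges allowed), directed to match the overcrossing: rotating so that the overstrand is directed from lower left to upper right, the edge points from the bottom region to the top region. An edge is positive or negative according to the sign of its crossing; $E=E_+\sqcup E_-$. Activities. Fix a root vertex $r\in V$ and a basepoint $q\in\mathbb{R}^2\setminus G$. Let $T$ be a spanning tree of $G$ (viewed as a set of edges). An edge $e\in T$ is internally semi-active if it points away from the component of $T\setminus\{e\}$ containing $r$, and internally semi-passive otherwise. For $e\in E\setminus T$, let $\mathrm{Cyc}_T(e)$ be the unique cycle in $T\cup\{e\}$, oriented counter-clockwise around $q$ in $\mathbb{R}^2\cup\{\infty\}$ (so that the side containing $q$ lies on its left); $e$ is externally semi-active if its direction agrees with this orientation, and externally semi-passive otherwise. Let $\iota_+(T)$, $\overline{\iota}_+(T)$ be the numbers of internally semi-active, respectively semi-passive, edges in $T\cap E_+$, and $\varepsilon_-(T)$, $\overline{\varepsilon}_-(T)$ the numbers of externally semi-active, respectively semi-passive, edges in $E_-\setminus T$. The polynomial. For an alternating diagram $D$ of $K$ with Tait digraph $G$, a root $r$, and a basepoint $q$ in a face of $G$ adjacent to $r$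 (its boundary contains $r$), $$P_K(x,y,z,w)=\sum_{T}x^{-\iota_+(T)}y^{-\overline{\iota}_+(T)}z^{\varepsilon_-(T)}w^{\overline{\varepsilon}_-(T)}\in\mathbb{Z}[x^{-1},y^{-1},z,w],$$ summed over all spanning trees $T$ of $G$. It does not depend on the choice of alternating diagram or of adjacent pair $(r,q)$. *)

(* Defs.v *)
From HB Require Import structures.
From mathcomp Require Import all_boot all_order all_algebra all_field.
From mathcomp Require Import mpoly.

Set Implicit Arguments.
Unset Strict Implicit.
Unset Printing Implicit Defensive.

Import Order.TTheory GRing.Theory Num.Theory.
Local Open Scope ring_scope.

(* Oriented link diagrams as planar diagram codes.  The four half-edges at a
   crossing c are (c, 0), (c, 1), (c, 2), (c, 3) in counter-clockwise order,
   where the understrand enters through 0 and leaves through 2; the overstrand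
   occupies 1 and 3, and runs from 3 to 1 at a positive crossing, from 1 to 3
   at a negative one.  [mate] exchanges the two halves of each edge. *)
Record pd_code := PDCode {
  crossing : finType;
  positive : pred crossing;
  mate : crossing * 'I_4 -> crossing * 'I_4 }.

(* The half-edge (c, k) also names the corner at c lying between the half-edges
   (c, k) and (c, k + 1), indices being taken modulo 4. *)
Notation dart D := (crossing D * 'I_4)%type.

Section Diagrams.

Variable D : pd_code.
Implicit Types (c : crossing D) (d : dart D) (R : {set dart D}).

(* The half-edges at c as seen with both strands pointing upward. *)
Definition upper_right c : 'I_4 := if positive c then 1 else 2%:R.
Definition upper_left c : 'I_4 := upper_right c + 1.
Definition lower_left c : 'I_4 := upper_right c + 2%:R.
Definition lower_right c : 'I_4 := upper_right c + 3%:R.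

Definition is_outgoing d := (d.2 == upper_right d.1) || (d.2 == upper_left d.1).

Definition is_over d := odd d.2.

(* The edge through the half-edge (c, k) has the corner (c, k) on its left when
   leaving c; at its other end (c', k') the same side is the corner
   (c', k' - 1). *)
Definition next_corner d : dart D := ((mate d).1, (mate d).2 - 1).

Definition region d : {set dart D} := [set x | fconnect next_corner d x].

Definition regions : {set {set dart D}} := [set region d | d : dart D].

Definition share_edge R R' :=
  [exists d : dart D,
     let l := region d in let r := region (d.1, d.2 - 1) in
     ((R == l) && (R' == r)) || ((R == r) && (R' == l))].

Definition crossing_adj : rel (crossing D) :=
  [rel c c' | [exists k : 'I_4, (mate (c, k)).1 == c']].

End Diagrams.

(* Connected diagrams in the sphere, i.e. of Euler characteristic 2, with n
   crossings and 2n edges.  A diagram of a non-split link is connected.  The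
   Euler characteristic forces n > 0: the circle without crossings is not
   encoded, but the unknot has diagrams with one crossing. *)
Record diagram := Diagram {
  code :> pd_code;
  mateK : involutive (@mate code);
  mate_outgoing : forall d, is_outgoing (@mate code d) = ~~ is_outgoing d;
  diagram_connected : forall c c', connect (@crossing_adj code) c c';
  diagram_planar : #|regions code| = (#|crossing code| + 2)%N }.

Definition alternating (D : diagram) : Prop :=
  forall d : dart D, is_over (mate d) = ~~ is_over d.

Section Alexander.

Variables (D : diagram) (F : fieldType).

Definition is_state (R R' : {set dart D}) (st : {ffun crossing D -> 'I_4}) :=
  [forall Q in regions D, (Q != R) && (Q != R') ==>
     (#|[set c | (c, st c) \in Q]| == 1%N)].

(* Here h stands for t^(1/2).  The top corner lies between the half-edges
   upper_right and upper_left, the bottom corner between lower_left and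
   lower_right. *)
Definition corner_weight (h : F) (c : crossing D) (k : 'I_4) : F :=
  if k == upper_right c then (if positive c then h else h^-1)
  else if k == lower_left c then (if positive c then - h^-1 else - h)
  else 1.

Definition kauffman_sum (R R' : {set dart D}) (h : F) : F :=
  \sum_(st : {ffun crossing D -> 'I_4} | is_state R R' st)
    \prod_(c : crossing D) corner_weight h c (st c).

End Alexander.

(* Seifert matrices.  Let S be the surface obtained from D by Seifert's
   algorithm.  A 1-cycle on S is pushed into the graph formed by the Seifert
   circles and one core arc per half-twisted band; it is given by its flow a
   along the edges of D (in the direction of D) and its flow b through the bands
   (from the left to the right strand).  The Seifert circles bound discs in S,
   so that H_1(S) is the group of these cycles modulo the circles, i.e. modulo
   the cycles with b = 0. *)
Section Seifert.

Variable D : diagram.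

Definition is_cycle (a : dart D -> int) (b : crossing D -> int) : Prop :=
  (forall d, a (mate d) = a d) /\
  (forall c, a (c, lower_left c) = a (c, upper_left c) + b c /\
             a (c, lower_right c) + b c = a (c, upper_right c)).

(* The linking number of the cycle (a, b) with the push-off of (a', b') in the
   positive normal direction of S.  Make S vertical near the Seifert circles,
   above them, so that the push-off is displaced to the left of each circle,
   and count with sign the places where (a, b) passes over the push-off.
   When (a', b') leaves the left strand of a crossing into the band, the
   push-off passes under (a, b), which contributes - a(upper_left) b'; the half
   twist of the band contributes - b b' at a positive crossing and nothing at a
   negative one.  Finally a(upper_left) + b = a(lower_left). *)
Definition seifert_form (a : dart D -> int) (b' : crossing D -> int) : int :=
  - \sum_(c : crossing D)
      a (c, if positive c then lower_left c else upper_left c) * b' c.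

(* V is the matrix of the Seifert form in some Z-basis of H_1(S). *)
Definition seifert_matrix m (V : 'M[int]_m) : Prop :=
  exists (a : 'I_m -> dart D -> int) (b : 'I_m -> crossing D -> int),
    [/\ forall i, is_cycle (a i) (b i),
        forall a' b', is_cycle a' b' ->
          exists! x : 'rV[int]_m, forall c, b' c = \sum_i x 0 i * b i c
      & V = \matrix_(i, j) seifert_form (a i) (b j)].

End Seifert.

(* For symmetric S, spectral_diag lists the eigenvalues with multiplicity. *)
Definition signature m (S : 'M[int]_m) : int :=
  let ev := spectral_diag (map_mx (intr : int -> algC) S) in
  #|[set i | 0 < ev 0 i]|%:Z - #|[set i | ev 0 i < 0]|%:Z.

(* The Tait digraph.  Rotating the picture at c so that the overstrand runs from
   lower left to upper right (in either direction), the top and bottom corners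
   are (c, 1) and (c, 3).  In an alternating diagram all corners of a region
   have indices of the same parity.  The edges of the digraph are the crossings
   of D, and its faces are the unshaded regions. *)
Section Tait.

Variable D : diagram.
Implicit Types (c e f : crossing D) (X T : {set crossing D}) (r q : {set dart D}).

Definition shaded : {set {set dart D}} :=
  [set region d | d : dart D & odd d.2].

Definition unshaded : {set {set dart D}} :=
  [set region d | d : dart D & ~~ odd d.2].

Definition over_out c : 'I_4 := if positive c then 1 else 3%:R.

(* With the overstrand directed from lower left to upper right, the corners top,
   left, bottom and right follow each other counter-clockwise, and the overstrand
   leaves just before the top one. *)
Definition head c := region (c, over_out c).
Definition left_face c := region (c, over_out c + 1).
Definition tail c := region (c, over_out c + 2%:R).
Definition right_face c := region (c, over_out c + 3%:R).

Definition vertex_adj X : rel {set dart D} :=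
  [rel v w | [exists e in X, ((tail e == v) && (head e == w)) ||
                             ((tail e == w) && (head e == v))]].

Definition face_adj X : rel {set dart D} :=
  [rel v w | [exists e in X, ((left_face e == v) && (right_face e == w)) ||
                             ((left_face e == w) && (right_face e == v))]].

(* The edge e lies on a cycle of the graph with edge set X. *)
Definition on_cycle X e :=
  (e \in X) && connect (vertex_adj (X :\ e)) (tail e) (head e).

Definition spanning_tree T :=
  [forall v in shaded, forall w in shaded, connect (vertex_adj T) v w] &&
  [forall e in T, ~~ on_cycle T e].

Definition cyc T e : {set crossing D} := [set f | on_cycle (e |: T) f].

(* e \in T points away from the component of T \ {e} containing r. *)
Definition int_semi_active r T e := connect (vertex_adj (T :\ e)) r (tail e).

(* The side of cyc T e containing q, on the left of the cycle when the latter is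
   oriented counter-clockwise around q, consists of the faces which can be
   reached from q without crossing the cycle. *)
Definition ext_semi_active q T e :=
  connect (face_adj (~: cyc T e)) q (left_face e).

Definition iota_pos r T : nat :=
  #|[set e in T | positive e & int_semi_active r T e]|.
Definition iota_bar_pos r T : nat :=
  #|[set e in T | positive e & ~~ int_semi_active r T e]|.
Definition eps_neg q T : nat :=
  #|[set e in ~: T | ~~ positive e & ext_semi_active q T e]|.
Definition eps_bar_neg q T : nat :=
  #|[set e in ~: T | ~~ positive e & ~~ ext_semi_active q T e]|.

(* The element of Z[x^-1, y^-1, z, w], the four variables being x^-1, y^-1, z
   and w in this order. *)
Definition tait_poly r q : {mpoly int[4]} :=
  \sum_(T : {set crossing D} | spanning_tree T)
    'X_[Multinom [tuple iota_pos r T; iota_bar_pos r T; eps_neg q T; eps_bar_neg q T]].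

Definition tait_eval (F : fieldType) r q (x y z w : F) : F :=
  (map_mpoly intr (tait_poly r q)).@[tnth [tuple x^-1; y^-1; z; w]].

End Tait.

(* Laurent polynomials in t^(1/2) are regarded as elements of the field of
   rational functions in t^(1/2). *)
Definition Lfield : fieldType := {fraction {poly algC}}.

Definition t_half : Lfield := tofrac 'X.
Definition t : Lfield := t_half ^+ 2.

(* A square root of -t. *)
Definition neg_t_half : Lfield := tofrac ('i%:P) * t_half.

(* Equality up to a constant unit, as allowed by the ambiguity of the Alexander
   polynomial; powers of t are excluded because Delta is symmetrized.  For even
   sigma, u is 1 or -1.  For odd sigma, (-t)^(-sigma/2) is not in
   Z[t^(1/2), t^(-1/2)], and u is i or -i.  In both cases
   f = u (-t)^(-sigma/2) g means f = t^(-sigma/2) g or f = - t^(-sigma/2) g. *)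
Definition eq_up_to_unit (sigma : int) (f g : Lfield) : Prop :=
  exists2 u : Lfield, u ^+ 2 = (-1) ^ sigma & f = u * g.

(* Main.v *)
(* Colour the regions black (shaded, vertices of the Tait digraph G) and white
   (faces of G). For a function f on regions let X f and Y f be its differences
   along the edges of G and across them. Everything rests on the orthogonality
   of X f and Y f', obtained by grouping the sum by half-edges, together with a
   dimension count from Euler's formula.

   Trees. A Kauffman state for an adjacent pair (r, q) assigns to each edge of G
   a vertex or a face; the edges assigned a vertex form a spanning tree T, and
   every edge of T, or of the dual tree, is assigned its end away from r, or q.
   Comparing weights gives the third formula for (R, R') = (r, q).

   Independence of (R, R'). The states have a common sign in a determinant with
   rows X + Y: for the restriction of the rows to T and its complement, the
   product with the unrestricted matrix has the positive definite quadratic form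
   sum_T X^2 + sum_{E - T} Y^2. After a change of signs of the columns the
   weighted matrix M(h) has the rows h^e N + h^-e S - W - E, e being the sign of
   the crossing. Its kernel is spanned by h^p and h^-p, where p is the Alexander
   numbering, so that its maximal minors at adjacent pairs agree up to sign. The
   sign is determined at h = i, where all trees have the same weight.

   Symmetry. M(h)^T diag(e) M(h) is invariant under the exchange of h and 1/h.

   Signature. The symmetrized Seifert form is the restriction of
   - |X|^2 + |(X - Y)_-|^2, where (-)_- is the restriction to negative edges, to
   a subspace of the (X, (X - Y)_-) containing its own orthogonal, so that the
   signature is |E_-| - |V| + 1. All terms of P are homogeneous of this degree,
   hence the first two formulas follow from the third one. *)

Require Import Defs.
From HB Require Import structures.
From mathcomp Require Import mpoly.
From mathcomp Require Import all_boot all_order perm all_algebra all_field.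
From mathcomp Require Import ring zify.

Set Implicit Arguments.
Unset Strict Implicit.
Unset Printing Implicit Defensive.

Import Order.TTheory GRing.Theory Num.Theory.
Local Open Scope ring_scope.


(** * Ranks and finite graphs *)

(** The hypothesis makes the rows of [A] indexed by [I0] linearly independent. *)
Lemma card_le_rank (F : fieldType) m n (A : 'M[F]_(m, n)) (I0 : {set 'I_m}) :
  (forall u : 'rV_m, (forall i, i \notin I0 -> u 0 i = 0) -> u *m A = 0 -> u = 0) ->
  (#|I0| <= \rank A)%N.
Proof.
move=> injA; pose f := @enum_val _ (mem I0).
have fA : rowsub f A = rowsub f 1%:M *m A by rewrite mul_rowsub_mx mul1mx.
suff /eqP rkB : row_free (rowsub f A).
  by rewrite -[leqLHS]rkB fA mxrankM_maxr.
apply/inj_row_free => v vA0.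
have u0 : v *m rowsub f (1%:M : 'M_m) = 0.
  apply: injA; last by rewrite -mulmxA -fA.
  move=> i iI0; rewrite mxE big1 // => k _; rewrite !mxE.
  case: eqP => [eki|_]; last by rewrite mulr0.
  by rewrite -eki enum_valP in iI0.
apply/rowP => k; rewrite mxE; have /rowP/(_ (f k)) := u0.
rewrite !mxE (bigD1 k) //= !mxE eqxx mulr1 big1 ?addr0 // => l nlk.
rewrite !mxE; case: eqP => [/enum_val_inj elk|_]; last by rewrite mulr0.
by rewrite elk eqxx in nlk.
Qed.

(** A linear system with fewer equations than unknowns would have a nonzero solution. Below, the
    unknowns are values on regions and the equations belong to edges. *)
Lemma card_le_of_injective (F : fieldType) (I J : finType) (a : I -> J -> F)
    (I0 : {set I}) (J0 : {set J}) :
  (forall f : I -> F, (forall i, i \notin I0 -> f i = 0) ->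
     (forall j, j \in J0 -> \sum_i f i * a i j = 0) -> forall i, f i = 0) ->
  (#|I0| <= #|J0|)%N.
Proof.
move=> inja; pose g := @enum_val _ (mem J0).
pose A := \matrix_(i < #|I|, j < #|J0|) a (enum_val i) (g j).
have -> : #|I0| = #|enum_rank @: I0|.
  by rewrite card_imset //; apply: enum_rank_inj.
apply: leq_trans (rank_leq_col A); apply: card_le_rank => u u0 uA0.
apply/rowP => i; rewrite mxE.
have := inja (fun i => u 0 (enum_rank i)) _ _ (enum_val i).
rewrite enum_valK; apply => [k kI0|j jJ0].
  by apply: u0; apply: contra kI0 => /imsetP[l lI0 /enum_rank_inj->].
have /rowP/(_ (enum_rank_in jJ0 j)) := uA0.
rewrite !mxE (reindex _ (onW_bij _ (@enum_rank_bij I))) /= => uA.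
rewrite -[RHS]uA.
by apply: eq_bigr => k _; rewrite !mxE enum_rankK /g enum_rankK_in.
Qed.

(** * Connectivity, forests and trees in a finite graph *)

Section Graph.

Variables (V E : finType) (p m : E -> V).
Implicit Types (X : {set E}) (S : {set V}) (e : E) (v w : V).

Definition graph_adj X : rel V :=
  [rel v w | [exists e in X, ((m e == v) && (p e == w)) ||
                             ((m e == w) && (p e == v))]].

Local Notation conn X := (connect (graph_adj X)).

Lemma graph_adjP X v w :
  reflect (exists2 e, e \in X & (m e = v /\ p e = w) \/ (m e = w /\ p e = v))
          (graph_adj X v w).
Proof.
apply: (iffP existsP) => [[e /andP[eX]]|[e eX evw]].
  by case/orP=> /andP[/eqP<- /eqP<-]; exists e => //; [left|right].
by exists e; rewrite eX; case: evw => -[-> ->]; rewrite !eqxx ?orbT.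
Qed.

Lemma graph_adj_sym X : symmetric (graph_adj X).
Proof.
by move=> v w; apply/graph_adjP/graph_adjP => -[e eX H]; exists e => //; tauto.
Qed.

Lemma graph_conn_sym X : connect_sym (graph_adj X).
Proof. exact/sym_connect_sym/graph_adj_sym. Qed.

Lemma conn_edge X e : e \in X -> conn X (m e) (p e).
Proof. by move=> eX; apply/connect1/graph_adjP; exists e => //; left. Qed.

Lemma conn_edgeE X e v : e \in X -> conn X v (m e) = conn X v (p e).
Proof.
by move=> eX; rewrite -!(graph_conn_sym X _ v) (same_connect (@graph_conn_sym X) (conn_edge eX)).
Qed.

Lemma conn_mono X (Y : {set E}) v w : X \subset Y -> conn X v w -> conn Y v w.
Proof.
move=> /subsetP sXY; apply: connect_sub => {}v {}w /graph_adjP[e eX H].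
by apply/connect1/graph_adjP; exists e => //; apply: sXY.
Qed.

Lemma conn_const (T : Type) (f : V -> T) X v w :
  (forall e, e \in X -> f (p e) = f (m e)) -> conn X v w -> f v = f w.
Proof.
move=> fX /connectP[s]; elim: s v => [|x s IHs] v /= => [_ ->//|].
case/andP=> /graph_adjP[e eX H] /IHs{}IHs /IHs<-.
by have := fX e eX; case: H => -[-> ->].
Qed.

(** A path from [r] stays in the component of [r], whereas an edge of [X] at [v] lies in another
    component, so the path does not use it. *)
Lemma conn_avoid X r u v e : conn X r u -> ~~ conn X r v ->
  m e = v \/ p e = v -> conn (X :\ e) r u.
Proof.
move=> ru rv ev; apply: contraT => nru.
have eX : e \in X.
  by apply: contraNT nru => eX; rewrite (setDidPl _) // disjoint_sym disjoints1.
suff : conn X r (p e) by case: ev rv => <-; rewrite ?conn_edgeE // => /negP.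
apply: contraNT nru => nre.
have fX f : f \in X -> conn X r (p f) && conn (X :\ e) r (p f) =
                       conn X r (m f) && conn (X :\ e) r (m f).
  move=> fX; rewrite (conn_edgeE r fX).
  have [->|nfe] := eqVneq f e; first by rewrite (negPf nre).
  by rewrite (@conn_edgeE (X :\ e)) // !inE nfe.
pose g w := conn X r w && conn (X :\ e) r w.
by have := @conn_const _ g X r u fX ru; rewrite /g !connect0 ru /= => <-.
Qed.

Definition conn_on S X := {in S &, forall v w, conn X v w}.

(** Absence of cycles, in the form that every edge is a bridge. *)
Definition forest X := [forall e in X, ~~ conn (X :\ e) (m e) (p e)].

Definition tree_on S X := conn_on S X /\ forest X.

(** In a tree this is the end of [e] away from the root [r], the one that a Kauffman state assigns
    to [e]. *)
Definition far X r e := if conn (X :\ e) r (m e) then p e else m e.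

Lemma far_end X r e : far X r e = m e \/ far X r e = p e.
Proof. by rewrite /far; case: ifP; tauto. Qed.

Section OnS.

Variable S : {set V}.
Hypotheses (pS : forall e, p e \in S) (mS : forall e, m e \in S).

(** A function vanishing at [r] and outside [S], with equal values at the ends of every edge of [X],
    is zero by connectedness: the unknowns are the vertices other than [r], the equations the
    edges. *)
Lemma conn_on_card X r : r \in S -> conn_on S X -> (#|S :\ r| <= #|X|)%N.
Proof.
move=> rS cX.
apply: (@card_le_of_injective rat _ _
         (fun v e => (p e == v)%:R - (m e == v)%:R)) => f fS fX v.
have [vS|vS] := boolP (v \in S); last by apply: fS; rewrite !inE negb_and vS orbT.
have <- : f r = 0 by apply: fS; rewrite !inE eqxx.
apply: (conn_const _ (cX _ _ vS rS)) => e /fX.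
under eq_bigr do rewrite mulrBr.
rewrite sumrB => /eqP; rewrite subr_eq0.
have sumf x : \sum_i f i * (x == i)%:R = f x.
  rewrite (bigD1 x) //= eqxx mulr1 big1 ?addr0 // => i.
  by rewrite eq_sym => /negPf->; rewrite mulr0.
by rewrite !sumf => /eqP.
Qed.

(** Removing an edge that is not a bridge would leave a connected graph with too few edges for
    [conn_on_card]. *)
Lemma conn_on_forest X r : r \in S -> conn_on S X -> (#|X| <= #|S :\ r|)%N ->
  forest X.
Proof.
move=> rS cX leX; apply/forallP => e; apply/implyP => eX; apply/negP => con_e.
suff /(conn_on_card rS) : conn_on S (X :\ e).
  by move: leX; rewrite (cardsD1 e X) eX; lia.
move=> v w vS wS; have := cX _ _ vS wS; apply: connect_sub.
move=> {vS wS}v {}w /graph_adjP[f fX H].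
have [efe|nfe] := eqVneq f e.
  by subst f; case: H => -[<- <-]; rewrite // graph_conn_sym.
by apply/connect1/graph_adjP; exists f => //; rewrite !inE nfe.
Qed.

Lemma forest_not_both X r e : forest X -> e \in X ->
  ~~ (conn (X :\ e) r (m e) && conn (X :\ e) r (p e)).
Proof.
move=> /forallP/(_ e)/implyP fX /fX; apply: contra => /andP[rm rp].
by rewrite graph_conn_sym in rm; apply: connect_trans rm rp.
Qed.

Lemma conn_on_one X r e : r \in S -> conn_on S X ->
  conn (X :\ e) r (m e) || conn (X :\ e) r (p e).
Proof.
move=> rS cX; apply: contraT; rewrite negb_or => /andP[nm np].
have := cX _ _ rS (mS e) => /(@conn_const _ (conn (X :\ e) r)).
rewrite connect0 (negPf nm) => H; suff /H : forall f, f \in X ->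
  conn (X :\ e) r (p f) = conn (X :\ e) r (m f) by [].
move=> f fX.
have [->|nfe] := eqVneq f e; first by rewrite (negPf nm) (negPf np).
by rewrite (@conn_edgeE (X :\ e)) // !inE nfe.
Qed.

Variables (X : {set E}) (r : V).
Hypotheses (rS : r \in S) (tX : tree_on S X).

Lemma far_disconn e : e \in X -> ~~ conn (X :\ e) r (far X r e).
Proof.
move=> eX; have := forest_not_both r tX.2 eX; rewrite /far.
by case cm: (conn (X :\ e) r (m e)); rewrite //= cm.
Qed.

Lemma near_conn e v : (v = m e \/ v = p e) -> v <> far X r e ->
  conn (X :\ e) r v.
Proof.
have := conn_on_one e rS tX.1; rewrite /far.
by case: ifP => [rm _|_ /= rp] [] ->.
Qed.

(** The path from [r] to the near end of [e] avoids the common far end, hence also [e']; then [e]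
    itself leads to the far end. *)
Lemma conn_far e e' : e \in X -> e' \in X -> e' != e ->
  far X r e' = far X r e -> conn (X :\ e') r (far X r e).
Proof.
move=> eX e'X ne' efar.
have eX' : e \in X :\ e' by rewrite !inE eX eq_sym ne'.
set u := if conn (X :\ e) r (m e) then m e else p e.
have [ru <-] : conn (X :\ e) r u /\ conn (X :\ e') r u = conn (X :\ e') r (far X r e).
  rewrite /u /far; have := conn_on_one e rS tX.1.
  by case: ifP => [->|_ /= ->]; rewrite (conn_edgeE r eX').
have H : m e' = far X r e \/ p e' = far X r e.
  by rewrite -efar; case: (far_end X r e') => ->; tauto.
apply: conn_mono (conn_avoid ru (far_disconn eX) H).
by apply/subsetP => x; rewrite !inE => /and3P[-> _ ->].
Qed.

Lemma far_inj : {in X &, injective (far X r)}.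
Proof.
move=> e e' eX e'X efar; apply/eqP; rewrite eq_sym; apply: contraT => ne.
have := far_disconn e'X; rewrite -efar.
by rewrite (conn_far eX e'X ne).
Qed.

Lemma far_neq_root e : e \in X -> far X r e != r.
Proof. by move=> /far_disconn; apply: contraNneq => ->. Qed.

Lemma far_in e : far X r e \in S.
Proof. by case: (far_end X r e) => ->. Qed.

Lemma far_sub : far X r @: X \subset S :\ r.
Proof.
by apply/subsetP => _ /imsetP[e eX ->]; rewrite !inE far_neq_root ?far_in.
Qed.

Lemma tree_card : #|X| = #|S :\ r|.
Proof.
apply/eqP; rewrite eqn_leq conn_on_card ?andbT //; last exact: tX.1.
by rewrite -(card_in_imset far_inj) subset_leq_card // far_sub.
Qed.

Lemma far_image : far X r @: X = S :\ r.
Proof.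
apply/eqP; rewrite eqEcard far_sub card_in_imset; last exact: far_inj.
by rewrite tree_card /= leqnn.
Qed.

(* Otherwise the part of the tree beyond e would contain at least as many edges
   as vertices. *)
Lemma choice_is_far (tau : E -> V) :
  (forall e, e \in X -> tau e = m e \/ tau e = p e) ->
  (forall v, v \in S :\ r -> exists2 e, e \in X & tau e = v) ->
  {in X &, injective tau} ->
  {in X, tau =1 far X r}.
Proof.
move=> tau_end tau_surj tau_inj e eX; apply/eqP; apply: contraT => /eqP ntau.
have nc := near_conn (tau_end e eX) ntau.
pose C := [set v in S | ~~ conn (X :\ e) r v].
pose XC := [set f in X | (m f \in C) && (p f \in C)].
have eXC : e \notin XC.
  rewrite !inE !mS !pS eX /= -negb_or.
  by have := conn_on_one e rS tX.1 => ->.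
have endC f : f \in X -> f != e -> (m f \in C) = (p f \in C).
  move=> fX nfe; rewrite !inE mS pS /=; congr (~~ _).
  by rewrite (@conn_edgeE (X :\ e)) // !inE nfe.
have C_le : (#|C| <= #|XC|)%N.
  apply: leq_trans (leq_imset_card tau XC); apply/subset_leq_card/subsetP => v vC.
  have vSr : v \in S :\ r.
    rewrite !inE; move: vC; rewrite inE => /andP[-> nrv]; rewrite andbT.
    by apply: contraNneq nrv => ->.
  have [f fX tfv] := tau_surj v vSr.
  apply/imsetP; exists f => //; rewrite inE fX /=.
  have nfe : f != e.
    by apply: contraTneq vC => fe; rewrite -tfv fe inE nc andbF.
  have := endC f fX nfe.
  by case: (tau_end f fX) => tf; rewrite -tf tfv vC; [move=> <-|move=> ->].
have : (#|XC| <= #|C :\ far X r e|)%N.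
  rewrite -(@card_in_imset _ _ (far X r)); last first.
    by move=> f g; rewrite !inE => /andP[fX _] /andP[gX _]; apply: far_inj.
  apply/subset_leq_card/subsetP => _ /imsetP[f fXC ->].
  move: (fXC); rewrite inE => /and3P[fX mfC pfC].
  rewrite in_setD1; apply/andP; split; last by case: (far_end X r f) => ->.
  by apply: contraNneq eXC => /(far_inj fX eX) <-.
rewrite leqNgt => /negP[]; apply: leq_trans C_le.
by rewrite [leqRHS](cardsD1 (far X r e)) inE far_in far_disconn //= add1n.
Qed.

End OnS.

End Graph.

(** * Regions and half-edges *)

Lemma odd_I4B1 (k : 'I_4) : odd (k - 1)%R = ~~ odd k.
Proof. by case: k => -[|[|[|[|]]]]. Qed.

Lemma odd_I4D (k l : 'I_4) : odd (k + l)%R = odd k (+) odd l.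
Proof. by case: k => -[|[|[|[|]]]] // ?; case: l => -[|[|[|[|]]]] ?. Qed.

Lemma I4_ind (P : 'I_4 -> Prop) : P 0 -> P 1 -> P 2%:R -> P 3%:R -> forall k, P k.
Proof.
move=> P0 P1 P2 P3 [[|[|[|[|k]]]] lt4] //.
- by rewrite (_ : Ordinal _ = 0) //; apply: val_inj.
- by rewrite (_ : Ordinal _ = 1) //; apply: val_inj.
- by rewrite (_ : Ordinal _ = 2%:R) //; apply: val_inj.
- by rewrite (_ : Ordinal _ = 3%:R) //; apply: val_inj.
Qed.

Lemma sum_I4 (V : nmodType) (F : 'I_4 -> V) :
  \sum_k F k = F 0 + F 1 + F 2%:R + F 3%:R.
Proof.
rewrite !big_ord_recl big_ord0 addr0 !addrA.
by congr (F _ + F _ + F _ + F _); apply: val_inj.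
Qed.

Lemma I4E :
  (((1 + 1)%R = 2%:R :> 'I_4) *
   ((1 + 2%:R)%R = 3%:R :> 'I_4) *
   ((1 + 3%:R)%R = 0%R :> 'I_4) *
   ((2%:R + 1)%R = 3%:R :> 'I_4) *
   ((2%:R + 2%:R)%R = 0%R :> 'I_4) *
   ((2%:R + 3%:R)%R = 1 :> 'I_4) *
   ((3%:R + 1)%R = 0%R :> 'I_4) *
   ((3%:R + 2%:R)%R = 1 :> 'I_4) *
   ((3%:R + 3%:R)%R = 2%:R :> 'I_4) *
   ((0 - 1)%R = 3%:R :> 'I_4) *
   ((1 - 1)%R = 0%R :> 'I_4) *
   ((2%:R - 1)%R = 1 :> 'I_4) *
   ((3%:R - 1)%R = 2%:R :> 'I_4))%type.
Proof. by repeat split; apply: val_inj. Qed.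

Section Dart.

Variable D : diagram.
Implicit Types (c : crossing D) (d : dart D) (Q : {set dart D}) (b : bool).

Lemma next_corner_inj : injective (@next_corner D).
Proof.
move=> d d' dd'; have e1 : (mate d).1 = (mate d').1 := congr1 fst dd'.
have e2 : (mate d).2 = (mate d').2 := addIr (- 1) (congr1 snd dd').
by apply: (can_inj (@mateK D)); rewrite [LHS]surjective_pairing e1 e2 -surjective_pairing.
Qed.

Lemma region_id d : d \in region d.
Proof. by rewrite inE connect0. Qed.

Lemma region_eq d x : x \in region d -> region x = region d.
Proof.
rewrite inE => dx; apply/setP => y; rewrite !inE.
by rewrite (same_connect (fconnect_sym next_corner_inj) dx).
Qed.

Lemma region_next d : region (next_corner d) = region d.
Proof. by apply: region_eq; rewrite inE fconnect1. Qed.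

Definition right_region d : {set dart D} := region (d.1, d.2 - 1).

Lemma right_mate d : right_region (mate d) = region d.
Proof. exact: region_next. Qed.

Lemma left_mate d : region (mate d) = right_region d.
Proof. by rewrite -right_mate mateK. Qed.

Lemma region_in d : region d \in regions D.
Proof. exact: imset_f. Qed.

Definition orient d : int := if is_outgoing d then 1 else -1.

Lemma orient_mate d : orient (mate d) = - orient d.
Proof. by rewrite /orient mate_outgoing; case: is_outgoing. Qed.

Lemma sum_crossing_dart (V : nmodType) (F : dart D -> V) :
  \sum_d F d = \sum_c \sum_k F (c, k).
Proof. by rewrite pair_big; apply: eq_bigr => -[]. Qed.

(** Every edge of the diagram has exactly one outgoing half, and the contributions of its two halves
    cancel. The orthogonality relations and the symmetry in h and 1/h rest on this. *)
Lemma sum_antisym (V : zmodType) (F : dart D -> V) :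
  (forall d, F (mate d) = - F d) -> \sum_d F d = 0.
Proof.
move=> antiF; rewrite (bigID (@is_outgoing D)) /= addrC.
rewrite (reindex _ (onW_bij _ (inv_bij (@mateK D)))) /=.
under eq_bigl do rewrite mate_outgoing negbK.
under eq_bigr do rewrite antiF.
by rewrite sumrN addNr.
Qed.

(** Indexing the colours by a boolean lets one argument serve both the Tait graph and its dual,
    which are exchanged by [~~ b]. *)
Definition color b := [set region d | d : dart D & odd d.2 == b].

Lemma color_true : color true = shaded D.
Proof.
by apply/setP => Q; apply/imsetP/imsetP => -[d]; rewrite inE => H ->; exists d;
  rewrite // inE; case: odd H.
Qed.

Lemma region_color d : region d \in color (odd d.2).
Proof. by apply: imset_f; rewrite inE. Qed.

(* The regions on the two sides of a half-edge have different colours; [side b]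
   is the one of colour [b]. *)
Definition side b d := if odd d.2 == b then region d else right_region d.

Lemma side_color b d : side b d \in color b.
Proof.
rewrite /side; case: eqP => [<-|/eqP nb]; first exact: region_color.
rewrite /right_region; apply: imset_f; rewrite inE /= odd_I4B1.
by case: odd b nb => -[].
Qed.

Lemma over_out_odd c : odd (over_out c).
Proof. by rewrite /over_out; case: positive. Qed.

(* The corners of colour [b] at a crossing, with the sign convention head minus
   tail for the shaded ones and right minus left for the unshaded ones. *)
Definition tgt_corner b c : 'I_4 := if b then over_out c else over_out c + 3%:R.
Definition src_corner b c : 'I_4 := over_out c + (if b then 2%:R else 1).
Definition tgt b c := region (c, tgt_corner b c).
Definition src b c := region (c, src_corner b c).

Lemma tgt_color b c : tgt b c \in color b.
Proof.
apply: imset_f; rewrite inE /= /tgt_corner.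
by case: b; rewrite ?odd_I4D over_out_odd.
Qed.

Lemma src_color b c : src b c \in color b.
Proof.
apply: imset_f; rewrite inE /= /src_corner odd_I4D over_out_odd.
by case: b.
Qed.

Lemma share_edgeP Q Q' : share_edge Q Q' ->
  exists d, (Q = side true d /\ Q' = side false d) \/ (Q = side false d /\ Q' = side true d).
Proof.
case/existsP => d /orP H; exists d; rewrite /side /right_region.
by case: odd H => -[] /andP[/eqP -> /eqP ->] /=; tauto.
Qed.

(** The diagram is connected: all half-edges are linked by moving along edges and around
    crossings. *)
Lemma connected_const (T : Type) (f : dart D -> T) :
  (forall d, f (mate d) = f d) -> (forall c k, f (c, k) = f (c, 0)) ->
  forall d d', f d = f d'.
Proof.
move=> fm fc; pose g c := f (c, 0).
have gC c c' : g c = g c'.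
  have /connectP[s + ->] := diagram_connected c c'.
  elim: s c => [//|x s IHs] c /= /andP[/existsP[k /eqP xE] /IHs <-].
  by rewrite /g -(fc c k) -fm (surjective_pairing (mate _)) xE fc.
by move=> [c k] [c' k']; rewrite fc [RHS]fc; apply: gC.
Qed.

End Dart.

Section Ends.

Variable D : diagram.
Implicit Types (c : crossing D) (d : dart D) (b : bool).

Lemma side_trueE c : [/\ side true (c, 0) = region (c, 3%:R), side true (c, 1) = region (c, 1),
  side true (c, 2%:R) = region (c, 1) & side true (c, 3%:R) = region (c, 3%:R)].
Proof. by rewrite /side /right_region /= !I4E. Qed.

Lemma side_falseE c : [/\ side false (c, 0) = region (c, 0), side false (c, 1) = region (c, 0),
  side false (c, 2%:R) = region (c, 2%:R) & side false (c, 3%:R) = region (c, 2%:R)].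
Proof. by rewrite /side /right_region /= !I4E. Qed.

Lemma ends_pos c : positive c ->
  [/\ tgt true c = region (c, 1), src true c = region (c, 3%:R),
      tgt false c = region (c, 0) & src false c = region (c, 2%:R)].
Proof. by rewrite /tgt /src /tgt_corner /src_corner /over_out => ->; rewrite !I4E. Qed.

Lemma ends_neg c : ~~ positive c ->
  [/\ tgt true c = region (c, 3%:R), src true c = region (c, 1),
      tgt false c = region (c, 2%:R) & src false c = region (c, 0)].
Proof.
by rewrite /tgt /src /tgt_corner /src_corner /over_out => /negPf ->; rewrite !I4E.
Qed.

Lemma side_end b c k : side b (c, k) = tgt b c \/ side b (c, k) = src b c.
Proof.
have [st0 st1 st2 st3] := side_trueE c; have [sf0 sf1 sf2 sf3] := side_falseE c.
have [/ends_pos[e1 e2 e3 e4]|/ends_neg[e1 e2 e3 e4]] := boolP (positive c);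
  elim/I4_ind: k; case: b; rewrite ?e1 ?e2 ?e3 ?e4 ?st0 ?st1 ?st2 ?st3 ?sf0 ?sf1 ?sf2 ?sf3; tauto.
Qed.

(** Each of the four half-edges at a crossing separates a shaded from an unshaded corner, and all
    four pairs of such corners occur. *)
Lemma ends_side b c Q Q' : Q = tgt b c \/ Q = src b c ->
  Q' = tgt (~~ b) c \/ Q' = src (~~ b) c ->
  exists d, side b d = Q /\ side (~~ b) d = Q'.
Proof.
have [st0 st1 st2 st3] := side_trueE c; have [sf0 sf1 sf2 sf3] := side_falseE c.
have [/ends_pos[e1 e2 e3 e4]|/ends_neg[e1 e2 e3 e4]] := boolP (positive c);
case: b => /=; rewrite e1 e2 e3 e4 => -[]->; case=> ->;
by [exists (c, 0)|exists (c, 1)|exists (c, 2%:R)|exists (c, 3%:R)].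
Qed.

End Ends.

(** * The two colours of an alternating diagram and their orthogonality *)

Section Alternating.

Variable D : diagram.
Hypothesis alt : alternating D.
Implicit Types (c : crossing D) (d : dart D) (b : bool).

(** Passing to the other half of an edge exchanges left and right and, by alternation, also the
    parity of the index; the two effects cancel. *)
Lemma side_mate b d : side b (mate d) = side b d.
Proof.
have /= := alt d; rewrite /is_over /side left_mate right_mate => ->.
by case: odd b => -[].
Qed.

Lemma region_parity d x : x \in region d -> odd x.2 = odd d.2.
Proof.
rewrite inE => /connectP[s + ->]; elim: s d => [//|y s IHs] d /= /andP[/eqP <- /IHs ->].
have /= := alt d; rewrite /is_over => H.
by rewrite odd_I4B1 H negbK.
Qed.

Lemma region_colorE d b : (region d \in color D b) = (odd d.2 == b).
Proof.
apply/idP/eqP => [/imsetP[x]|<-]; last exact: region_color.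
rewrite inE => /eqP <- dx; apply: region_parity.
by rewrite -dx region_id.
Qed.

Lemma color_neq b Q Q' : Q \in color D b -> Q' \in color D (~~ b) -> Q != Q'.
Proof.
move=> /imsetP[d]; rewrite inE => /eqP db -> Q'b; apply: contraTneq Q'b => <-.
by rewrite region_colorE db; case: b db.
Qed.

Lemma color_sub b : color D b \subset regions D.
Proof. by apply/subsetP => _ /imsetP[d _ ->]; apply: region_in. Qed.

Lemma color_disjoint b : [disjoint color D b & color D (~~ b)].
Proof.
apply/pred0P => Q; apply/negbTE/negP => /andP[/= Qb /(color_neq Qb)].
by rewrite eqxx.
Qed.

Lemma regionsU b : regions D = color D b :|: color D (~~ b).
Proof.
apply/eqP; rewrite eqEsubset subUset !color_sub !andbT.
apply/subsetP => _ /imsetP[d _ ->]; rewrite inE !region_colorE.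
by case: odd b => -[].
Qed.

Lemma card_colors b : (#|color D b| + #|color D (~~ b)|)%N = (#|crossing D| + 2)%N.
Proof.
have := diagram_planar D; rewrite (regionsU b) cardsU => <-.
by have /disjoint_setI0 -> := color_disjoint b; rewrite cards0 subn0.
Qed.

Lemma color_const (T : Type) (f : {set dart D} -> T) b :
  (forall c, f (tgt b c) = f (src b c)) -> {in color D b &, forall Q Q', f Q = f Q'}.
Proof.
move=> fE; suff fs : forall d d', f (side b d) = f (side b d').
  move=> _ _ /imsetP[d + ->] /imsetP[d' + ->]; rewrite !inE => db d'b.
  by have := fs d d'; rewrite /side db d'b.
apply: connected_const => [d|c k]; first by rewrite side_mate.
have fb l : f (side b (c, l)) = f (src b c) by case: (side_end b c l) => ->.
by rewrite !fb.
Qed.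

Lemma color_nonempty b : exists Q, Q \in color D b.
Proof.
have : (0 < #|crossing D| + 2)%N by lia.
rewrite -(card_colors b) addn_gt0 => /orP[] /card_gt0P[Q] => [Qb|]; first by exists Q.
move=> /imsetP[d _ _]; exists (side b d); exact: side_color.
Qed.

Section Flow.

Variables (F : comNzRingType) (al : dart D -> F).
Hypotheses (al_mate : forall d, al (mate d) = - al d)
  (al_sum : forall c, \sum_k al (c, k) = 0).

(* The flow through the edges of the graph of colour [b]; for the flow of a
   function on regions, it is the difference of the values at the two ends. *)
Definition jump (al : dart D -> F) b c : F :=
  if b then al (c, over_out c) + al (c, over_out c - 1)
  else - (al (c, over_out c) + al (c, over_out c + 1)).

(** Grouped by edges, the sum of [al d * f (side (~~ b) d)] vanishes, since [al] changes sign
    between the two halves and [side] does not change. Grouped by crossings, it is the present sum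
    up to a sign depending on [b]. *)
Lemma jump_orth b (f : {set dart D} -> F) :
  \sum_c jump al b c * (f (tgt (~~ b) c) - f (src (~~ b) c)) = 0.
Proof.
have : \sum_d al d * f (side (~~ b) d) = 0.
  by apply: sum_antisym => d; rewrite side_mate al_mate mulNr.
rewrite sum_crossing_dart => /(congr1 ( *%R (if b then 1 else -1))).
rewrite mulr0 mulr_sumr => H; rewrite -[RHS]H {H}.
apply: eq_bigr => c _; have := al_sum c; rewrite !sum_I4 => ac.
have {ac}ac : al (c, 3%:R) = - (al (c, 0) + al (c, 1) + al (c, 2%:R)).
  by apply/eqP; rewrite -addr_eq0 addrC ac.
have [st0 st1 st2 st3] := side_trueE c; have [sf0 sf1 sf2 sf3] := side_falseE c.
rewrite /jump /over_out.
have [/[dup] cp /ends_pos[e1 e2 e3 e4]|/[dup] cn /ends_neg[e1 e2 e3 e4]] := boolP (positive c).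
  by case: b => /=; rewrite ?e1 ?e2 ?e3 ?e4 ?I4E ?st0 ?st1 ?st2 ?st3 ?sf0 ?sf1 ?sf2 ?sf3 ac; ring.
by case: b => /=; rewrite ?e1 ?e2 ?e3 ?e4 ?I4E ?st0 ?st1 ?st2 ?st3 ?sf0 ?sf1 ?sf2 ?sf3 ac; ring.
Qed.

End Flow.

Section Delta.

Variable F : comNzRingType.
Implicit Types (f g : {set dart D} -> F).

Definition delta b f c : F := f (tgt b c) - f (src b c).

Definition grad f d : F := f (region d) - f (right_region d).

Lemma grad_mate f d : grad f (mate d) = - grad f d.
Proof. by rewrite /grad left_mate right_mate opprB. Qed.

Lemma grad_sum f c : \sum_k grad f (c, k) = 0.
Proof. by rewrite sum_I4 /grad /right_region /= !I4E; ring. Qed.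

Lemma jump_grad b f c : jump (grad f) b c = delta b f c.
Proof.
rewrite /jump /grad /delta /right_region /tgt /src /tgt_corner /src_corner /over_out /=.
by case: positive; case: b; rewrite /= ?I4E; ring.
Qed.

(** In the plane, functions on the faces give the circulations of the graph, and these are
    orthogonal to its cuts. *)
Lemma delta_orth b f g : \sum_c delta b f c * delta (~~ b) g c = 0.
Proof.
rewrite -[RHS](jump_orth (grad_mate f) (grad_sum f) b g).
by apply: eq_bigr => c _; rewrite jump_grad.
Qed.

End Delta.

End Alternating.

(** * Plane duality *)

Section Duality.

Variable D : diagram.
Hypothesis alt : alternating D.
Implicit Types (c e : crossing D) (d : dart D) (b : bool) (X T : {set crossing D}).

Local Notation gconn b X := (connect (graph_adj (@tgt D b) (@src D b) X)).
Local Notation forest b X := (forest (@tgt D b) (@src D b) X).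
Local Notation conn_on b X := (conn_on (@tgt D b) (@src D b) (color D b) X).
Local Notation tree_on b X := (tree_on (@tgt D b) (@src D b) (color D b) X).

(** [delta (~~ b) k] is a circulation supported on [X]. If [e] were a bridge of [X], pairing it with
    the cut around the component of [src b e] in [X :\ e] would leave only the nonzero value at
    [e]. *)
Lemma flow_on_cycle b X (k : {set dart D} -> rat) e :
  (forall c, c \notin X -> delta (~~ b) k c = 0) -> delta (~~ b) k e != 0 ->
  e \in X /\ gconn b (X :\ e) (src b e) (tgt b e).
Proof.
move=> kX ke; have eX : e \in X by apply: contraNT ke => /kX ->.
split=> //; apply: contraT => nc.
pose g Q : rat := (gconn b (X :\ e) (src b e) Q)%:R.
have := delta_orth alt b g k; rewrite (bigD1 e) //= big1 => [|c nce]; last first.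
  have [cX|/kX ->] := boolP (c \in X); last by rewrite mulr0.
  by rewrite /delta /g (@conn_edgeE _ _ _ _ (X :\ e)) ?inE ?nce ?subrr ?mul0r.
rewrite addr0 {1}/delta /g connect0 (negPf nc) sub0r mulN1r => /eqP.
by rewrite oppr_eq0 (negPf ke).
Qed.

Lemma delta_comp b X Q (f : bool -> rat) c : c \in X ->
  delta b (fun Q' => f (gconn b X Q Q')) c = 0.
Proof. by move=> cX; rewrite /delta (conn_edgeE _ _ Q cX) subrr. Qed.

Lemma forest_dual_conn b T : forest b T -> conn_on (~~ b) (~: T).
Proof.
move=> fT Q Q' Qb Q'b; pose k x : rat := (gconn (~~ b) (~: T) Q x)%:R.
have k0 c : delta (~~ b) k c = 0.
  apply/eqP; apply: contraT => kc.
  have kT c' : c' \notin T -> delta (~~ b) k c' = 0.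
    by move=> cT; apply: (@delta_comp (~~ b) (~: T) Q (fun x : bool => (x : nat)%:R)); rewrite inE.
  have [cT] := flow_on_cycle kT kc.
  by have /forallP/(_ c)/implyP/(_ cT)/negbTE -> := fT.
have := @color_const D alt _ k (~~ b) _ Q Q' Qb Q'b; rewrite /k connect0 => H.
have {H} /eqP : 1 = (gconn (~~ b) (~: T) Q Q')%:R :> rat.
  by apply: H => c; apply/eqP; rewrite -subr_eq0; apply/eqP/k0.
by case: connect.
Qed.

Lemma card_crossing_colors b Q Q' : Q \in color D b -> Q' \in color D (~~ b) ->
  #|crossing D| = (#|color D b :\ Q| + #|color D (~~ b) :\ Q'|)%N.
Proof.
move=> Qb Q'b; have := card_colors alt b.
by rewrite (cardsD1 Q (color D b)) (cardsD1 Q' (color D (~~ b))) Qb Q'b; lia.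
Qed.

(** By Euler's formula the complement has one edge fewer than the dual graph has vertices, so that
    its connectedness makes it a tree. *)
Lemma tree_dual b T : tree_on b T -> tree_on (~~ b) (~: T).
Proof.
move=> tT; have cT := forest_dual_conn tT.2; split=> //.
have [Q Qb] := color_nonempty alt b; have [Q' Q'b] := color_nonempty alt (~~ b).
apply: (conn_on_forest Q'b cT).
have := card_crossing_colors Qb Q'b.
have -> := esym (tree_card (@tgt_color D _) (@src_color D _) Qb tT).
by have := cardsC T; lia.
Qed.

(** A region is a single orbit of [next_corner], so its boundary is one closed walk in the graph of
    the other colour, along which [g] does not change. *)
Lemma face_boundary (U : Type) (g : {set dart D} -> U) b Q :
  (forall c, tgt (~~ b) c = Q \/ src (~~ b) c = Q -> g (tgt b c) = g (src b c)) ->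
  forall d d', side (~~ b) d = Q -> side (~~ b) d' = Q -> g (side b d) = g (side b d').
Proof.
move=> gQ.
have gE c k k' : side (~~ b) (c, k) = Q -> g (side b (c, k)) = g (side b (c, k')).
  move=> ckQ; have {}ckQ : tgt (~~ b) c = Q \/ src (~~ b) c = Q.
    by rewrite -ckQ; case: (side_end (~~ b) c k) => ->; tauto.
  by case: (side_end b c k) => ->; case: (side_end b c k') => ->; rewrite ?gQ.
have step d : odd d.2 = ~~ b -> region d = Q ->
    [/\ odd (next_corner d).2 = ~~ b, region (next_corner d) = Q &
        g (side b (next_corner d)) = g (side b d)].
  move=> db dQ; have nb : odd (next_corner d).2 = ~~ b.
    by rewrite -db (@region_parity D alt d) // inE fconnect1.
  split; rewrite ?region_next // -[in RHS](side_mate alt) [in RHS](surjective_pairing (mate d)).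
  by apply: gE; rewrite /side nb eqxx region_next.
have conn d d' : odd d.2 = ~~ b -> region d = Q -> d' \in Q -> g (side b d) = g (side b d').
  move=> db dQ; rewrite -{1}dQ inE => /connectP[s + ->].
  elim: s d db dQ => [//|x s IHs] d db dQ /= /andP[/eqP <-].
  by have [nb nQ <-] := step d db dQ; apply: IHs.
suff norm d : side (~~ b) d = Q -> exists d', [/\ odd d'.2 = ~~ b, region d' = Q &
    side b d' = side b d].
  move=> d d' /norm[x [xb xQ <-]] /norm[y [yb yQ <-]].
  by apply: conn => //; rewrite -yQ region_id.
rewrite /side; case: eqP => [db dQ|/eqP db dQ]; first by exists d; rewrite db.
exists (mate d); have /= := alt d; rewrite /is_over left_mate right_mate => ->.
by split=> //; case: (odd _) db => //; case: b {gQ gE step conn}.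
Qed.

(* Otherwise let [F0] be the component of the second fixed region. The edges
   which do not touch [F0] receive, by injectivity of the choice, at least as
   many vertices and faces; a rank computation for the subgraph formed by the
   boundaries of the faces in [F0] contradicts Euler's formula. *)
Lemma choice_dual_conn b X (ch : crossing D -> {set dart D}) d0 :
  (forall c, c \in X -> ch c = tgt b c \/ ch c = src b c) ->
  (forall c, c \notin X -> ch c = tgt (~~ b) c \/ ch c = src (~~ b) c) ->
  (forall Q, Q \in regions D -> Q != side b d0 -> Q != side (~~ b) d0 ->
     exists c, ch c = Q) ->
  conn_on (~~ b) (~: X).
Proof.
move=> chX chnX ch_surj.
set r := side b d0 in ch_surj *; set q := side (~~ b) d0 in ch_surj *.
have rb : r \in color D b by apply: side_color.
have qb : q \in color D (~~ b) by apply: side_color.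
pose F0 := [set Q in color D (~~ b) | gconn (~~ b) (~: X) q Q].
have [F0all|] := boolP (color D (~~ b) \subset F0).
  move=> Q Q' /(subsetP F0all) + /(subsetP F0all); rewrite !inE.
  move=> /andP[_ qQ] /andP[_]; apply: connect_trans.
  by rewrite graph_conn_sym.
case/subsetPn=> Qx Qxb QxF0; exfalso.
(* The vertices on the boundaries of the faces in [F0], and then the edges of these boundaries. *)
pose V0 := [set v in color D b | [exists d, (side b d == v) && (side (~~ b) d \in F0)]].
pose E0 := [set c | (tgt (~~ b) c \in F0) || (src (~~ b) c \in F0)].
have sV0 : V0 \subset color D b by apply/subsetP => x; rewrite inE => /andP[].
have sF0 : F0 \subset color D (~~ b) by apply/subsetP => x; rewrite inE => /andP[].
have notb x : x \in color D (~~ b) -> x \notin color D b.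
  by move=> xb; apply/negP => /(color_neq alt)/(_ xb); rewrite eqxx.
have qF0 : q \in F0 by rewrite inE qb connect0.
have rV0 : r \in V0 by rewrite inE rb; apply/existsP; exists d0; rewrite eqxx.
have F0X e : e \in ~: X -> (tgt (~~ b) e \in F0) = (src (~~ b) e \in F0).
  by move=> eX; rewrite !inE tgt_color src_color (conn_edgeE _ _ q eX).
have leE0 : (#|V0 :\ r :|: F0| <= #|E0|)%N.
  apply: (@card_le_of_injective rat _ _ (fun Q c =>
     ((tgt b c == Q)%:R - (src b c == Q)%:R) + ((tgt (~~ b) c == Q)%:R - (src (~~ b) c == Q)%:R))).
  move=> f fsupp fE0.
  have sumf x : \sum_i f i * (x == i)%:R = f x.
    rewrite (bigD1 x) //= eqxx mulr1 big1 ?addr0 // => i.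
    by rewrite eq_sym => /negPf->; rewrite mulr0.
  have {}fE0 c : c \in E0 -> delta b f c + delta (~~ b) f c = 0.
    move=> /fE0; under eq_bigr do rewrite mulrDr !mulrBr.
    by rewrite big_split !sumrB !sumf.
  have fF x : x \in color D (~~ b) -> x \notin F0 -> f x = 0.
    move=> xb xF0; apply: fsupp; apply/negP => /setUP[/setD1P[_ /(subsetP sV0)]|].
      exact/negP/notb.
    exact/negP.
  (* Multiplied by [delta (~~ b) f], which vanishes outside [E0], and summed, the equations leave by
     orthogonality a vanishing sum of squares. *)
  have d0c c : delta (~~ b) f c = 0.
    have : \sum_c delta (~~ b) f c ^+ 2 = 0.
      have : \sum_c delta b f c * delta (~~ b) f c + \sum_c delta (~~ b) f c ^+ 2 = 0.
        rewrite -big_split /=; apply: big1 => c' _; rewrite expr2 -mulrDl.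
        have [c'E|] := boolP (c' \in E0); first by rewrite fE0 // mul0r.
        rewrite inE negb_or => /andP[tF sF].
        by rewrite [delta (~~ b) f c']/delta !fF ?tgt_color ?src_color // subrr mulr0.
      by rewrite (delta_orth alt) add0r.
    move=> /eqP; rewrite psumr_eq0 => [|c' _]; last exact: sqr_ge0.
    by move=> /allP/(_ c); rewrite mem_index_enum sqrf_eq0 => /(_ isT)/eqP.
  have fQ x : x \in color D (~~ b) -> f x = 0.
    move=> xb; rewrite -(fF Qx) //; apply: (color_const alt _ xb Qxb) => c.
    by apply/eqP; rewrite -subr_eq0; apply/eqP/d0c.
  have fE c : c \in E0 -> f (tgt b c) = f (src b c).
    by move/fE0; rewrite d0c addr0 => /eqP; rewrite subr_eq0 => /eqP.
  have fr : f r = 0.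
    apply: fsupp; rewrite in_setU !inE eqxx /= negb_and; apply/orP; left.
    by apply/negP => /notb/negP; apply.
  (* For a face of [F0], [f] takes the value [f r] all along its boundary. This holds at [q] and
     passes across the edges outside [X], hence reaches all of [F0]. *)
  pose G Q := (Q \in F0) ==> [forall d, (side (~~ b) d == Q) ==> (f (side b d) == f r)].
  have Gface Q : Q \in F0 -> (exists2 d, side (~~ b) d = Q & f (side b d) = f r) -> G Q.
    move=> QF [d dQ fd]; rewrite /G QF /=; apply/forallP => d'; apply/implyP => /eqP d'Q.
    rewrite -fd; apply/eqP; apply: (@face_boundary _ f b Q) => // c cQ.
    by apply: fE; rewrite inE; case: cQ => ->; rewrite QF ?orbT.
  have GX e : e \in ~: X -> G (tgt (~~ b) e) = G (src (~~ b) e).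
    move=> eX; have FX := F0X e eX.
    have [tF|tF] := boolP (tgt (~~ b) e \in F0); last by rewrite /G -FX (negPf tF).
    have sF : src (~~ b) e \in F0 by rewrite -FX.
    have eE : e \in E0 by rewrite inE tF.
    have H x y : x = tgt (~~ b) e \/ x = src (~~ b) e -> y = tgt (~~ b) e \/ y = src (~~ b) e ->
        x \in F0 -> y \in F0 -> G x -> G y.
      move=> xe ye xF yF Gx; apply: Gface => //.
      have ex z (ze : z = tgt (~~ b) e \/ z = src (~~ b) e) :=
        ends_side (or_introl (erefl (tgt b e))) ze.
      have [dy [dy1 dy2]] := ex y ye; exists dy => //; rewrite dy1.
      have [dx [<- dx2]] := ex x xe.
      by move: Gx; rewrite /G xF => /forallP/(_ dx); rewrite dx2 eqxx => /eqP.
    by apply/idP/idP; apply: H; tauto.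
  have Gq : G q by apply: Gface => //; exists d0.
  move=> Q; have [QI|/fsupp//] := boolP (Q \in V0 :\ r :|: F0).
  move: QI; rewrite in_setU => /orP[|]; last by rewrite inE => /andP[/fQ].
  rewrite in_setD1 => /andP[_]; rewrite inE => /andP[_ /existsP[d /andP[/eqP <- dF]]].
  move: (dF); rewrite inE => /andP[_ qd].
  have := conn_const GX qd; rewrite Gq /G dF => /esym/forallP/(_ d).
  by rewrite eqxx fr => /eqP.
(* The remaining regions are all chosen, and only by edges not touching [F0]: a vertex outside [V0]
   shares no half-edge with [F0], and an edge outside [X] does not leave [F0]. *)
have leE1 : (#|(color D b :\: V0) :|: (color D (~~ b) :\: F0)| <= #|~: E0|)%N.
  apply: leq_trans (leq_imset_card ch _); apply/subset_leq_card/subsetP => Q.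
  rewrite in_setU => /orP[] /setDP[Qb QV].
    have [||c cQ] := ch_surj Q (subsetP (color_sub _ _) _ Qb).
    - by apply: contraNneq QV => ->.
    - exact: (color_neq alt Qb qb).
    apply/imsetP; exists c => //; rewrite in_setC inE negb_or.
    have cX : c \in X.
      apply: contraT => /chnX; rewrite cQ => H.
      have : Q \in color D (~~ b) by case: H => ->; rewrite ?tgt_color ?src_color.
      by move=> /(color_neq alt Qb); rewrite eqxx.
    have {cX}Qc := chX c cX; rewrite cQ in Qc.
    have H y : y = tgt (~~ b) c \/ y = src (~~ b) c -> y \notin F0.
      move=> yc; apply: contraNN QV => yF; rewrite inE Qb; apply/existsP.
      by have [d [d1 d2]] := ends_side Qc yc; exists d; rewrite d1 d2 eqxx.
    by apply/andP; split; apply: H; tauto.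
  have [||c cQ] := ch_surj Q (subsetP (color_sub _ _) _ Qb).
  - by rewrite eq_sym; apply: (color_neq alt rb Qb).
  - by apply: contraNneq QV => ->.
  apply/imsetP; exists c => //.
  have cX : c \in ~: X.
    rewrite inE; apply: contraT; rewrite negbK => /chX; rewrite cQ => H.
    have : Q \in color D b by case: H => ->; rewrite ?tgt_color ?src_color.
    by move=> /(color_neq alt)/(_ Qb); rewrite eqxx.
  have := F0X c cX; move: cX; rewrite inE => /chnX; rewrite cQ => Qc FX.
  rewrite in_setC inE negb_or.
  by case: Qc FX QV => -> => [<-|->] ->.
have Vd (A B : {set {set dart D}}) : A \subset color D b -> B \subset color D (~~ b) ->
    #|A :|: B| = (#|A| + #|B|)%N.
  move=> sA sB; rewrite cardsU (_ : A :&: B = set0) ?cards0 ?subn0 //.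
  apply/eqP; rewrite -subset0; apply/subsetP => x /setIP[/(subsetP sA) xA /(subsetP sB)].
  by move=> /(color_neq alt xA); rewrite eqxx.
(* The two left-hand sides count all n + 2 regions except [r], the two right-hand sides the n
   crossings. *)
move: leE0 leE1; rewrite !Vd ?subsetDl //; last exact: subset_trans (subsetDl _ _) sV0.
have := card_colors alt b; have := cardsID V0 (color D b).
have := cardsID F0 (color D (~~ b)); rewrite (setIidPr sV0) (setIidPr sF0).
have := cardsC E0; rewrite (cardsD1 r V0) rV0 /= add1n.
move: #|E0| #|~: E0| #|crossing D| #|F0| #|_ :\: F0|
  #|color D (~~ b)| #|V0 :\ r| #|_ :\: V0| #|color D b|.
lia.
Qed.

End Duality.

(** * States and spanning trees *)

Section States.

Variable D : diagram.
Hypothesis alt : alternating D.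
Implicit Types (c e : crossing D) (d : dart D) (b : bool) (X T : {set crossing D}).
Implicit Types (Q R r q : {set dart D}) (st : {ffun crossing D -> 'I_4}).

Local Notation gconn b X := (connect (graph_adj (@tgt D b) (@src D b) X)).
Local Notation forest b X := (forest (@tgt D b) (@src D b) X).
Local Notation conn_on b X := (conn_on (@tgt D b) (@src D b) (color D b) X).
Local Notation tree_on b X := (tree_on (@tgt D b) (@src D b) (color D b) X).
Local Notation gfar b := (far (@tgt D b) (@src D b)).

Lemma spanning_treeP T : reflect (tree_on true T) (spanning_tree T).
Proof.
apply: (iffP andP) => -[cT fT]; split.
- move=> v w; rewrite color_true => vS wS.
  by have /forallP/(_ v)/implyP/(_ vS)/forallP/(_ w)/implyP/(_ wS) := cT.
- apply/forallP => e; apply/implyP => eT.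
  by have /forallP/(_ e)/implyP/(_ eT) := fT; rewrite /on_cycle eT.
- apply/forallP => v; apply/implyP => vS; apply/forallP => w; apply/implyP => wS.
  by apply: cT; rewrite color_true.
- apply/forallP => e; apply/implyP => eT.
  by have /forallP/(_ e)/implyP/(_ eT) := fT; rewrite /on_cycle eT.
Qed.

(* The fundamental cycle of e separates the two sides of e, and it is contained
   in T and e, so that the faces on either side of it are the two components of
   the dual tree without e. *)
Lemma ext_semi_activeE T e q : tree_on true T -> e \notin T -> q \in color D false ->
  ext_semi_active q T e = gconn false ((~: T) :\ e) q (src false e).
Proof.
move=> tT eT qF; have [cT' fT'] := tree_dual alt tT.
have sub : (~: T) :\ e \subset ~: cyc T e.
  apply/subsetP => x; rewrite !inE => /andP[nxe xT].
  by rewrite /on_cycle !inE (negPf nxe) (negPf xT).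
have esE : ext_semi_active q T e = gconn false (~: cyc T e) q (src false e) by [].
rewrite esE; apply/idP/idP => [qs|]; last exact: conn_mono.
have := conn_on_one (@src_color D false) e qF cT'.
case/orP=> // qt; exfalso.
have {qs qt}st : gconn false (~: cyc T e) (src false e) (tgt false e).
  apply: connect_trans (conn_mono sub qt).
  by rewrite graph_conn_sym.
pose k Q : rat := (gconn false ((~: T) :\ e) (src false e) Q)%:R.
have kcyc c : c \in ~: cyc T e -> k (tgt false c) = k (src false c).
  move=> cc; apply/eqP; rewrite -subr_eq0; apply: contraTT cc => kc.
  have kX c' : c' \notin e |: T -> delta (~~ true) k c' = 0.
    rewrite !inE negb_or => c'X.
    apply: (@delta_comp _ false ((~: T) :\ e) (src false e) (fun x : bool => (x : nat)%:R)).
    by rewrite !inE.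
  have [cX cc] := flow_on_cycle alt kX kc.
  by rewrite !inE negbK; apply/andP.
have /eqP := conn_const kcyc st; rewrite /k connect0.
have /forallP/(_ e)/implyP := fT'; rewrite inE => /(_ eT)/negbTE /= ->.
by [].
Qed.

Definition chosen st c := region (c, st c).

Lemma region_memE Q c k : Q \in regions D -> ((c, k) \in Q) = (region (c, k) == Q).
Proof.
move=> /imsetP[d _ ->]; apply/idP/eqP => [/region_eq//|<-]; exact: region_id.
Qed.

Lemma state_surj R R' st : is_state R R' st ->
  forall Q, Q \in regions D -> Q != R -> Q != R' -> exists c, chosen st c = Q.
Proof.
move=> /forallP H Q QD QR QR'; have /implyP/(_ QD) := H Q; rewrite QR QR' => /cards1P[c cE].
exists c; apply/eqP; rewrite -region_memE //.
by have := set11 c; rewrite -cE inE.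
Qed.

Section TwoRegions.

Variables R R' : {set dart D}.
Hypotheses (RD : R \in regions D) (R'D : R' \in regions D) (nRR' : R != R').

Lemma card_regions_rest : #|regions D :\: [set R; R']| = #|crossing D|.
Proof.
have := cardsID [set R; R'] (regions D).
rewrite diagram_planar (setIidPr _) ?cards2 ?nRR' /=;
  first by move=> /eqP; rewrite addnC eqn_add2r => /eqP.
by apply/subsetP => x; rewrite !inE => /orP[] /eqP ->.
Qed.

(** There are as many crossings as regions other than the two fixed ones, so a choice reaching all
    of these is a bijection onto them. *)
Lemma surj_inj st :
  (forall Q, Q \in regions D -> Q != R -> Q != R' -> exists c, chosen st c = Q) ->
  injective (chosen st) /\ (forall c, chosen st c != R /\ chosen st c != R').
Proof.
move=> surj.
have sub : regions D :\: [set R; R'] \subset chosen st @: setT.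
  apply/subsetP => Q; rewrite !inE negb_or => /andP[/andP[QR QR'] /surj[]// c <-].
  exact: imset_f.
have cimg : #|chosen st @: setT| = #|crossing D|.
  apply/eqP; rewrite eqn_leq -{2}card_regions_rest subset_leq_card // andbT.
  by apply: leq_trans (leq_imset_card _ _) _; rewrite cardsT.
split=> [x y|c].
  by apply: (imset_injP _) => //; rewrite cimg cardsT.
have /eqP E : regions D :\: [set R; R'] == chosen st @: setT.
  by rewrite eqEcard sub cimg card_regions_rest /=.
have : chosen st c \in regions D :\: [set R; R'] by rewrite E imset_f.
by rewrite !inE negb_or => /andP[/andP].
Qed.

Lemma surj_state st :
  (forall Q, Q \in regions D -> Q != R -> Q != R' -> exists c, chosen st c = Q) ->
  is_state R R' st.
Proof.
move=> surj; have [inj _] := surj_inj surj.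
apply/forallP => Q; apply/implyP => QD; apply/implyP => /andP[QR QR'].
have [c cQ] := surj Q QD QR QR'; apply/cards1P; exists c.
apply/setP => x; rewrite !inE region_memE // -cQ.
by apply/eqP/eqP => [/inj|->].
Qed.

End TwoRegions.

Section Adjacent.

Variable d0 : dart D.
Let r := side true d0.
Let q := side false d0.

Let rV : r \in color D true. Proof. exact: side_color. Qed.
Let qF : q \in color D false. Proof. exact: side_color. Qed.
Let rD : r \in regions D. Proof. exact: (subsetP (color_sub _ _) _ rV). Qed.
Let qD : q \in regions D. Proof. exact: (subsetP (color_sub _ _) _ qF). Qed.
Let nrq : r != q. Proof. exact: (color_neq alt rV qF). Qed.

(** A semi-active edge of [T] points away from the root, so its far end is its head. Outside [T] the
    dual edge is directed from the left to the right face, and the right one is far from [q] when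
    the edge is semi-active. *)
Definition tree_state T : {ffun crossing D -> 'I_4} :=
  [ffun c => if c \in T
             then if int_semi_active r T c then tgt_corner true c else src_corner true c
             else if ext_semi_active q T c then tgt_corner false c else src_corner false c].

(** Odd corners are shaded: these are the crossings to which the state assigns a vertex of the Tait
    graph. *)
Definition odd_set st : {set crossing D} := [set c | odd (st c)].

Lemma tree_stateK T : odd_set (tree_state T) = T.
Proof.
apply/setP => c; rewrite inE ffunE /tgt_corner /src_corner.
by case: (c \in T); case: ifP => _; rewrite ?odd_I4D ?over_out_odd.
Qed.

Lemma chosen_tree_state T c : tree_on true T ->
  chosen (tree_state T) c = if c \in T then gfar true T r c else gfar false (~: T) q c.
Proof.
move=> tT; rewrite /chosen ffunE; have [cT|cT] := boolP (c \in T).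
  by rewrite /far /tgt /src -/(int_semi_active r T c); case: int_semi_active.
by rewrite /far -(ext_semi_activeE tT cT qF) /tgt /src; case: ext_semi_active.
Qed.

Lemma tree_state_surj T : tree_on true T ->
  forall Q, Q \in regions D -> Q != r -> Q != q -> exists c, chosen (tree_state T) c = Q.
Proof.
move=> tT Q; rewrite (regionsU alt true) => /setUP[QV|QF] nr nq.
  have : Q \in color D true :\ r by rewrite !inE nr.
  rewrite -(far_image (@tgt_color D _) (@src_color D _) rV tT) => /imsetP[c cT ->].
  by exists c; rewrite chosen_tree_state // cT.
have : Q \in color D false :\ q by rewrite !inE nq.
rewrite -(far_image (@tgt_color D _) (@src_color D _) qF (tree_dual alt tT)).
move=> /imsetP[c]; rewrite inE => cT ->.
by exists c; rewrite chosen_tree_state // (negPf cT).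
Qed.

Lemma corner_odd st c : odd (st c) ->
  st c = tgt_corner true c \/ st c = src_corner true c.
Proof.
rewrite /tgt_corner /src_corner /over_out.
by case: positive; elim/I4_ind: (st c) => //= _; rewrite ?I4E; tauto.
Qed.

Lemma corner_even st c : ~~ odd (st c) ->
  st c = tgt_corner false c \/ st c = src_corner false c.
Proof.
rewrite /tgt_corner /src_corner /over_out.
by case: positive; elim/I4_ind: (st c) => //= _; rewrite ?I4E; tauto.
Qed.

(** Connectedness is [choice_dual_conn] with the colours exchanged. The vertices chosen by the edges
    of the set are distinct and differ from [r], which bounds the number of edges. *)
Lemma state_tree st : is_state r q st -> tree_on true (odd_set st).
Proof.
move=> /state_surj surj; have [inj avoid] := surj_inj rD qD nrq surj.
set T := odd_set st.
have chT c : c \in T -> chosen st c = tgt true c \/ chosen st c = src true c.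
  by rewrite inE => /corner_odd; rewrite /chosen => -[] ->; [left|right].
have chnT c : c \notin T -> chosen st c = tgt false c \/ chosen st c = src false c.
  by rewrite inE => /corner_even; rewrite /chosen => -[] ->; [left|right].
have cT : conn_on true T.
  rewrite -[T]setCK; apply: (@choice_dual_conn _ alt false _ (chosen st) d0).
  - by move=> c; rewrite inE => /chnT.
  - by move=> c; rewrite inE negbK => /chT.
  - by move=> Q QD nq nr; apply: surj.
split=> //; apply: (conn_on_forest rV cT).
rewrite -(card_imset _ inj); apply/subset_leq_card/subsetP => _ /imsetP[c cc ->].
rewrite !inE (avoid c).1 /=.
by case: (chT c cc) => ->; rewrite ?tgt_color ?src_color.
Qed.

Lemma tree_state_odd_set st : is_state r q st -> tree_state (odd_set st) = st.
Proof.
move=> sst; have tT := state_tree sst; move: sst.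
move=> /state_surj surj; have [inj avoid] := surj_inj rD qD nrq surj.
set T := odd_set st in tT *.
have chT c : c \in T -> chosen st c = tgt true c \/ chosen st c = src true c.
  by rewrite inE => /corner_odd; rewrite /chosen => -[] ->; [left|right].
have chnT c : c \notin T -> chosen st c = tgt false c \/ chosen st c = src false c.
  by rewrite inE => /corner_even; rewrite /chosen => -[] ->; [left|right].
have tT' := tree_dual alt tT.
have farT : {in T, chosen st =1 gfar true T r}.
  apply: (choice_is_far (@tgt_color D _) (@src_color D _) rV tT).
  - by move=> e /chT; tauto.
  - move=> v; rewrite !inE => /andP[vr vV].
    have [|c cv] := surj v (subsetP (color_sub _ _) _ vV) vr.
      exact: (color_neq alt vV qF).
    exists c => //; apply: contraT => /chnT; rewrite cv => H.
    have : v \in color D (~~ true) by case: H => ->; rewrite ?tgt_color ?src_color.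
    by move=> /(color_neq alt vV); rewrite eqxx.
  - by move=> x y _ _; apply: inj.
have farF : {in ~: T, chosen st =1 gfar false (~: T) q}.
  apply: (choice_is_far (@tgt_color D _) (@src_color D _) qF tT').
  - by move=> e; rewrite inE => /chnT; tauto.
  - move=> v; rewrite !inE => /andP[vq vF].
    have [|c cv] := surj v (subsetP (color_sub _ _) _ vF) _ vq.
      by rewrite eq_sym; apply: (color_neq alt rV vF).
    exists c => //; rewrite inE; apply/negP => /chT; rewrite cv => H.
    have : v \in color D true by case: H => ->; rewrite ?tgt_color ?src_color.
    by move=> /(color_neq alt)/(_ vF); rewrite eqxx.
  - by move=> x y _ _; apply: inj.
have chE c : chosen (tree_state T) c = chosen st c.
  rewrite chosen_tree_state //; case: ifP => [/farT ->//|cT].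
  by rewrite farF // inE cT.
(* An edge of a forest has distinct ends, so that the chosen region determines the chosen corner. *)
have noloop b X e : forest b X -> e \in X -> tgt b e <> src b e.
  move=> /forallP/(_ e)/implyP fX /fX; apply: contraNnot => ->; exact: connect0.
have TK := tree_stateK T.
apply/ffunP => c; have := chE c; rewrite /chosen.
have oE : odd (tree_state T c) = odd (st c).
  by have /setP/(_ c) := TK; rewrite !inE.
have [cT|cT] := boolP (c \in T).
  have nl := noloop true T c tT.2 cT.
  have so : odd (st c) by move: cT; rewrite inE.
  have to : odd (tree_state T c) by rewrite oE.
  have [->|->] := corner_odd to; have [->|->] := corner_odd so => //.
  by move=> H; case: nl.
have cT' : c \in ~: T by rewrite inE.
have nl := noloop false (~: T) c tT'.2 cT'.
have so : ~~ odd (st c) by move: cT; rewrite inE.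
have to : ~~ odd (tree_state T c) by rewrite oE.
have [->|->] := corner_even to; have [->|->] := corner_even so => //.
by move=> H; case: nl.
Qed.

Lemma sum_states (V : nmodType) (f : {ffun crossing D -> 'I_4} -> V) :
  \sum_(st | is_state r q st) f st = \sum_(T | spanning_tree T) f (tree_state T).
Proof.
rewrite (reindex_onto tree_state odd_set) => [|st]; last exact: tree_state_odd_set.
apply: eq_bigl => T; rewrite tree_stateK eqxx andbT.
apply/idP/spanning_treeP => [/state_tree|tT]; first by rewrite tree_stateK.
by apply: surj_state => //; apply: tree_state_surj.
Qed.

Lemma prod_if_card (F : comPzSemiRingType) (A : {set crossing D}) (x : F) :
  \prod_c (if c \in A then x else 1) = x ^+ #|A|.
Proof. by rewrite -big_mkcond prodr_const. Qed.

(** The top and bottom corners, which alone have a weight other than 1, are shaded at a positive and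
    unshaded at a negative crossing. Hence only positive edges in [T] and negative edges outside [T]
    contribute. *)
Lemma tree_state_weight (F : fieldType) (h : F) T :
  \prod_c corner_weight h c (tree_state T c) =
  h ^+ iota_pos r T * (- h^-1) ^+ iota_bar_pos r T *
  h^-1 ^+ eps_neg q T * (- h) ^+ eps_bar_neg q T.
Proof.
rewrite -!prod_if_card -!big_split; apply: eq_bigr => c _ /=.
rewrite !inE ffunE /corner_weight /tgt_corner /src_corner /lower_left /upper_right /over_out.
case: (c \in T); case: (positive c); case: int_semi_active; case: ext_semi_active;
  by rewrite /= ?I4E /= ?mulr1 ?mul1r.
Qed.

End Adjacent.

Lemma tait_evalE (F : fieldType) r q (x y z w : F) :
  tait_eval r q x y z w = \sum_(T : {set crossing D} | spanning_tree T)
    x^-1 ^+ iota_pos r T * y^-1 ^+ iota_bar_pos r T * z ^+ eps_neg q T * w ^+ eps_bar_neg q T.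
Proof.
rewrite /tait_eval /tait_poly (rmorph_sum (map_mpoly (intr : int -> F))).
rewrite (rmorph_sum (meval _)); apply: eq_bigr => T _.
rewrite /= map_mpolyX mevalX !big_ord_recl big_ord0 mulr1 !mulrA.
by rewrite !multinomE /= !(tnth_nth 0) /=.
Qed.

End States.

(** * Exactness of flows *)

Section Exactness.

Variable D : diagram.
Hypothesis alt : alternating D.
Implicit Types (c e : crossing D) (d : dart D) (b : bool) (Q : {set dart D}).

Local Notation n := #|crossing D|.

Definition reg (j : 'I_(n + 2)) : {set dart D} :=
  enum_val (cast_ord (esym (diagram_planar D)) j).

Lemma reg_in j : reg j \in regions D.
Proof. exact: enum_valP. Qed.

Lemma reg_inj : injective reg.
Proof. by move=> i j /enum_val_inj /cast_ord_inj. Qed.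

Lemma reg_surj Q : Q \in regions D -> exists j, reg j = Q.
Proof.
move=> QD; exists (cast_ord (diagram_planar D) (enum_rank_in QD Q)).
by rewrite /reg cast_ordK enum_rankK_in.
Qed.

Lemma sum_reg (F : pzSemiRingType) (f : {set dart D} -> F) Q : Q \in regions D ->
  \sum_j f (reg j) * (Q == reg j)%:R = f Q.
Proof.
move=> /reg_surj[j <-]; rewrite (bigD1 j) //= eqxx mulr1 big1 ?addr0 // => i nij.
by rewrite (inj_eq reg_inj) eq_sym (negPf nij) mulr0.
Qed.

Lemma sum_cr (V : nmodType) (f : crossing D -> V) :
  \sum_(i < n) f (enum_val i) = \sum_c f c.
Proof. by rewrite [RHS](reindex _ (onW_bij _ (@enum_val_bij _))). Qed.

Section Field.

Variable F : fieldType.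

Definition fun_of_row (u : 'rV[F]_(n + 2)) Q : F := \sum_j u 0 j * (Q == reg j)%:R.

Lemma fun_of_rowE u j : fun_of_row u (reg j) = u 0 j.
Proof.
rewrite /fun_of_row (bigD1 j) //= eqxx mulr1 big1 ?addr0 // => i nij.
by rewrite (inj_eq reg_inj) eq_sym (negPf nij) mulr0.
Qed.

Definition incidence b : 'M[F]_(n + 2, n) :=
  \matrix_(j, i) ((tgt b (enum_val i) == reg j)%:R - (src b (enum_val i) == reg j)%:R).

Lemma mul_incidence b u i : (u *m incidence b) 0 i = delta b (fun_of_row u) (enum_val i).
Proof.
rewrite mxE /delta /fun_of_row -sumrB; apply: eq_bigr => j _.
by rewrite !mxE mulrBr.
Qed.

Lemma incidence_orth b : incidence b *m (incidence (~~ b))^T = 0.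
Proof.
apply/matrixP => j k; rewrite !mxE.
have := delta_orth alt b (fun Q => (Q == reg j)%:R : F) (fun Q => (Q == reg k)%:R).
by rewrite -sum_cr => H; rewrite -[RHS]H; apply: eq_bigr => i _; rewrite !mxE /delta.
Qed.

Lemma incidence_rank_ge b : (#|color D b| <= (\rank (incidence b)).+1)%N.
Proof.
have [Q Qb] := color_nonempty alt b; rewrite (cardsD1 Q) Qb add1n ltnS.
pose I0 := [set j | reg j \in color D b :\ Q].
have -> : #|color D b :\ Q| = #|I0|.
  rewrite -(card_imset _ reg_inj); congr #|pred_of_set _|; apply/setP => x.
  apply/idP/imsetP => [xb|[j + ->]]; last by rewrite inE.
  have [j jx] : exists j, reg j = x.
    by apply: reg_surj; move: xb; rewrite inE => /andP[_ /(subsetP (color_sub _ _))].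
  by exists j; rewrite ?inE ?jx // -?in_setD1.
apply: card_le_rank => u u0 uA.
have dE c : fun_of_row u (tgt b c) = fun_of_row u (src b c).
  apply/eqP; rewrite -subr_eq0 -[c]enum_rankK -/(delta _ _ _) -mul_incidence.
  by rewrite uA mxE.
apply/rowP => j; rewrite mxE; have [jI|/u0//] := boolP (j \in I0).
have jb : reg j \in color D b by move: jI; rewrite !inE => /andP[].
rewrite -fun_of_rowE (color_const alt dE jb Qb).
have [k kQ] := reg_surj (subsetP (color_sub _ _) _ Qb).
by rewrite -kQ fun_of_rowE; apply: u0; rewrite !inE kQ eqxx.
Qed.

(** Connectedness bounds both ranks from below, and by Euler's formula these bounds add up to n;
    orthogonality bounds the sum of the ranks by n from above. *)
Lemma incidence_rank b :
  (\rank (incidence b)).+1 = #|color D b| /\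
  (\rank (incidence b) + \rank (incidence (~~ b)))%N = n.
Proof.
have := incidence_rank_ge b; have := incidence_rank_ge (~~ b).
have := card_colors alt b.
have : (incidence b <= kermx (incidence (~~ b))^T)%MS.
  by apply/sub_kermxP; apply: incidence_orth.
move=> /mxrankS; rewrite mxrank_ker mxrank_tr.
have := rank_leq_col (incidence (~~ b)); lia.
Qed.

Lemma incidence_exact b : (incidence b :=: kermx (incidence (~~ b))^T)%MS.
Proof.
apply/eqmxP; rewrite -mxrank_leqif_eq; last first.
  by apply/sub_kermxP; apply: incidence_orth.
by have := (incidence_rank b).2; rewrite mxrank_ker mxrank_tr => H; apply/eqP; lia.
Qed.

Section Flow.

Variable al : dart D -> F.
Hypotheses (al_mate : forall d, al (mate d) = - al d)
  (al_sum : forall c, \sum_k al (c, k) = 0).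

Lemma jump_incidence b : (\row_i jump al b (enum_val i)) *m (incidence (~~ b))^T = 0.
Proof.
apply/rowP => j; rewrite !mxE.
rewrite -[RHS](jump_orth alt al_mate al_sum b (fun Q => (Q == reg j)%:R)) -sum_cr.
by apply: eq_bigr => i _; rewrite !mxE.
Qed.

Lemma jump_delta b : exists f, forall c, jump al b c = delta b f c.
Proof.
have : (\row_i jump al b (enum_val i) <= incidence b)%MS.
  by rewrite incidence_exact; apply/sub_kermxP/jump_incidence.
case/submxP => u uE; exists (fun_of_row u) => c.
by have /rowP/(_ (enum_rank c)) := uE; rewrite mul_incidence mxE enum_rankK.
Qed.

(* Matching the two colours separately determines the flow up to a multiple of
   the flow alternating around each crossing, which is the gradient of the
   indicator function of the shaded regions. *)
Lemma flow_grad : exists f, forall d, al d = grad f d.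
Proof.
have [g gE] := jump_delta true; have [k kE] := jump_delta false.
pose f0 Q := if Q \in color D true then g Q else k Q.
have f0E b c : jump al b c = delta b f0 c.
  rewrite /delta /f0; have := tgt_color b c; have := src_color b c.
  case: b => [-> ->|sF tF]; first exact: gE.
  have notV Q : Q \in color D false -> (Q \in color D true) = false.
    by move=> QF; apply/negP => /(color_neq alt)/(_ QF); rewrite eqxx.
  by rewrite !notV.
pose be d := al d - grad f0 d.
pose ka d := if odd d.2 then - be d else be d.
have ka_mate d : ka (mate d) = ka d.
  have /= := alt d; rewrite /is_over /ka /be al_mate grad_mate => ->.
  by case: odd; rewrite /=; ring.
have ka_c c l : ka (c, l) = ka (c, 0).
  have bs : \sum_k be (c, k) = 0 by rewrite sumrB al_sum grad_sum subrr.
  have bj b : jump be b c = 0.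
    rewrite -[RHS](subrr (jump al b c)) {2}f0E -jump_grad.
    by case: b; rewrite /jump /be; ring.
  move: bs (bj true) (bj false); rewrite /jump sum_I4 /ka => bs b1 b2.
  have {}b1 : be (c, over_out c - 1) = - be (c, over_out c).
    by apply/eqP; rewrite -addr_eq0 addrC b1.
  have {}b2 : be (c, over_out c + 1) = - be (c, over_out c).
    by apply/eqP; rewrite -addr_eq0 addrC -oppr_eq0 b2.
  move: b1 b2; rewrite /over_out; case: positive; rewrite !I4E => b1 b2;
    move: bs; rewrite b1 b2 ?addNr ?add0r => /eqP.
    rewrite addrC addr_eq0 opprK => /eqP b3.
    by elim/I4_ind: l; rewrite /= ?b1 ?b2 ?b3.
  rewrite addrNK addrC subr_eq0 => /eqP b3.
  by elim/I4_ind: l; rewrite /= ?b1 ?b2 ?b3 ?opprK.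
have [_ /imsetP[d0 _ _]] := color_nonempty alt true.
have ka0 d := connected_const ka_mate ka_c d d0.
exists (fun Q => f0 Q - (if Q \in color D true then ka d0 else 0)) => d.
have := ka0 d; rewrite /grad /right_region !region_colorE // /= odd_I4B1 /ka.
by case: ifP => /= _ <-; rewrite /be /grad /right_region; ring.
Qed.

End Flow.
End Field.

(* The floor of a rational potential of an integral flow is an integral one. *)
Lemma numbering : exists p : {set dart D} -> int,
  forall d, p (region d) - p (right_region d) = orient d.
Proof.
pose al d : rat := (orient d)%:~R.
have alm d : al (mate d) = - al d by rewrite /al orient_mate rmorphN.
have als c : \sum_k al (c, k) = 0.
  rewrite sum_I4 /al /orient /is_outgoing /upper_left /upper_right /=.
  by case: positive; rewrite !I4E /=; ring.
have [f fE] := flow_grad alm als.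
exists (fun Q => Num.floor (f Q)) => d.
have : f (region d) = f (right_region d) + (orient d)%:~R.
  by have := fE d; rewrite /al /grad => ->; ring.
by move=> ->; rewrite real_floorDrz ?num_real ?intr_int // intrKfloor addrAC subrr add0r.
Qed.

End Exactness.

(** * Bordered Alexander matrices *)

(** Induction on the Schur complement of the first entry, also for a non-symmetric [G]. The
    complement inherits positivity by evaluating the form at the vector v extending y for which the
    first coordinate of G v is 0. *)
Lemma det_gt0 (R : realFieldType) n (G : 'M[R]_n) :
  (forall v : 'cV_n, v != 0 -> 0 < (v^T *m G *m v) 0 0) -> 0 < \det G.
Proof.
elim: n G => [|n IHn] G Gpos; first by rewrite det_mx00.
rewrite -[n.+1]/(1 + n)%N in G Gpos *.
pose a := ulsubmx G 0 0; pose b := ursubmx G; pose c := dlsubmx G; pose d := drsubmx G.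
have GE : G = block_mx a%:M b c d by rewrite -[LHS]submxK [ulsubmx G]mx11_scalar.
have quad x (y : 'cV_n) : ((col_mx x%:M y)^T *m G *m col_mx x%:M y) 0 0 =
    x * a * x + x * (b *m y) 0 0 + (y^T *m c) 0 0 * x + (y^T *m d *m y) 0 0.
  rewrite GE tr_col_mx mul_row_block mul_row_col tr_scalar_mx !mulmxDl.
  rewrite !mul_mx_scalar !mul_scalar_mx -!scalemxAl.
  move: (y^T *m c) (b *m y) (y^T *m d *m y) => yc by_ ydy.
  by rewrite !mxE eqxx !mulr1n; ring.
have a_gt0 : 0 < a.
  have := Gpos (col_mx 1%:M 0); rewrite quad trmx0 !mul0mx !mulmx0 !mxE !mul1r !mulr1 !addr0.
  apply; apply/eqP => /colP/(_ (lshift n 0)).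
  by rewrite col_mxEu !mxE eqxx => /eqP; rewrite oner_eq0.
have a_unit : a \is a GRing.unit by rewrite unitfE gt_eqF.
have -> : \det G = a * \det (d - c *m (a^-1 *: b)).
  have -> : G = block_mx 1%:M 0 (a^-1 *: c) 1%:M *m block_mx a%:M b 0 (d - c *m (a^-1 *: b)).
    rewrite mulmx_block !mul0mx !mul1mx !addr0 mul_mx_scalar scalerA mulrV // scale1r.
    by rewrite -scalemxAl -scalemxAr addrC subrK -GE.
  by rewrite det_mulmx det_lblock det_ublock !det1 !mul1r det_scalar1.
rewrite mulr_gt0 //; apply: IHn => y y0.
have := Gpos (col_mx (- (a^-1 * (b *m y) 0 0))%:M y); rewrite quad.
have -> : col_mx (- (a^-1 * (b *m y) 0 0))%:M y != 0.
  apply: contraNneq y0 => /eqP; rewrite col_mx_eq0 => /andP[_ /eqP ->//].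
have -> : (y^T *m (d - c *m (a^-1 *: b)) *m y) 0 0 =
    (y^T *m d *m y) 0 0 - (y^T *m c) 0 0 * (a^-1 * (b *m y) 0 0).
  rewrite mulmxBr mulmxBl [LHS]mxE; congr (_ + _); rewrite [LHS]mxE; congr (- _).
  rewrite -scalemxAr -scalemxAr -scalemxAl [LHS]mxE mulrCA; congr (_ * _).
  by rewrite mulmxA -(mulmxA (y^T *m c)) [LHS]mxE big_ord1.
move: ((y^T *m c) 0 0) ((b *m y) 0 0) ((y^T *m d *m y) 0 0) => p q r /(_ isT).
by congr (0 < _); field; rewrite gt_eqF.
Qed.

Lemma complete_unit (F : fieldType) n k (V : 'M[F]_(k, n + k)) : row_free V ->
  exists W : 'M[F]_(n, n + k), col_mx W V \in unitmx.
Proof.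
move=> /eqP rV; have rC : \rank (V^C)%MS = n by rewrite mxrank_compl rV addnK.
exists (castmx (rC, erefl) (row_base (V^C)%MS)).
rewrite -row_full_unit -sub1mx -addsmxE.
apply: submx_trans (_ : (V + V^C <= _)%MS); first by rewrite sub1mx addsmx_compl_full.
by rewrite addsmxC addsmxS // eqmx_cast eq_row_base.
Qed.

(* Two maximal minors of a matrix of corank 2 are proportional to the
   complementary minors of its kernel. *)
Lemma det_kernel (F : fieldType) n k (M : 'M[F]_(n, n + k)) (A B : 'M[F]_(k, n + k))
    (V : 'M[F]_(n + k, k)) :
  M *m V = 0 -> \det (B *m V) != 0 ->
  \det (col_mx M A) * \det (B *m V) = \det (col_mx M B) * \det (A *m V).
Proof.
move=> MV BV.
have fV : row_free V^T.
  rewrite -row_leq_rank mxrank_tr.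
  have : row_full (B *m V) by rewrite row_full_unit unitmxE unitfE.
  by move=> /eqP rBV; rewrite -[leqLHS]rBV mxrankM_maxr.
have [W uW] := complete_unit fV; set U := (col_mx W V^T)^T.
have dU : \det U != 0 by rewrite det_tr -unitfE -unitmxE.
have key C : \det (col_mx M C) * \det U = \det (M *m W^T) * \det (C *m V).
  by rewrite -det_mulmx /U tr_col_mx trmxK mul_col_row MV det_lblock.
by apply: (mulIf dU); rewrite mulrAC key [RHS]mulrAC key mulrAC.
Qed.

Section Bordered.

Variable D : diagram.
Hypothesis alt : alternating D.
Implicit Types (c e : crossing D) (d : dart D) (b : bool) (Q R : {set dart D}).
Implicit Types (st : {ffun crossing D -> 'I_4}) (T : {set crossing D}).

Local Notation n := #|crossing D|.

Section Ring.

Variable F : comNzRingType.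
Implicit Types (w : crossing D -> 'I_4 -> F) (f : {set dart D} -> F).

Definition corner_mx w : 'M[F]_(n, n + 2) :=
  \matrix_(i, j) \sum_k w (enum_val i) k * (region (enum_val i, k) == reg j)%:R.

Definition border_mx R R' : 'M[F]_(2, n + 2) :=
  \matrix_(i, j) ((if i == 0 then R else R') == reg j)%:R.

(** For distinct regions, the determinant is up to sign the minor of [corner_mx w] without the
    columns of [R] and [R']. *)
Definition bordered w R R' : 'M[F]_(n + 2) := col_mx (corner_mx w) (border_mx R R').

Definition indic st c (k : 'I_4) : F := (k == st c)%:R.

Definition corner_sum w f c := \sum_k w c k * f (region (c, k)).

Lemma corner_mx_mul w f i :
  (corner_mx w *m \col_j f (reg j)) i 0 = corner_sum w f (enum_val i).
Proof.
rewrite mxE; under eq_bigr do rewrite !mxE mulr_suml.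
rewrite exchange_big; apply: eq_bigr => k _; rewrite -(sum_reg f (region_in _)) mulr_sumr.
by apply: eq_bigr => j _; rewrite mulrAC -mulrA.
Qed.

Lemma border_mx_mul R R' f i : R \in regions D -> R' \in regions D ->
  (border_mx R R' *m \col_j f (reg j)) i 0 = if i == 0 then f R else f R'.
Proof.
move=> RD R'D; rewrite mxE; under eq_bigr do rewrite !mxE mulrC.
by rewrite sum_reg //; case: ifP.
Qed.

(** Multilinearity in the rows of the crossings, each of which is a combination of four corners. *)
Lemma det_bordered w R R' : \det (bordered w R R') =
  \sum_(st : {ffun crossing D -> 'I_4})
     (\prod_c w c (st c)) * \det (bordered (indic st) R R').
Proof.
pose a (s : {perm 'I_(n + 2)}) c k : F :=
  (region (c, k) == reg (s (lshift 2 (enum_rank c))))%:R.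
pose bs (s : {perm 'I_(n + 2)}) : F := \prod_(i < 2) border_mx R R' i (s (rshift n i)).
have detE v : \det (bordered v R R') =
    \sum_(s : {perm 'I_(n + 2)}) (-1) ^+ s * ((\prod_c \sum_k v c k * a s c k) * bs s).
  apply: eq_bigr => s _; congr (_ * _); rewrite big_split_ord /=; congr (_ * _).
    rewrite [RHS](reindex _ (onW_bij _ (@enum_val_bij _))) /=.
    apply: eq_bigr => i _; rewrite col_mxEu mxE; apply: eq_bigr => k _.
    by rewrite /a enum_valK.
  by apply: eq_bigr => i _; rewrite col_mxEd.
under [RHS]eq_bigr do rewrite detE mulr_sumr.
rewrite exchange_big detE; apply: eq_bigr => s _ /=.
rewrite bigA_distr_bigA /= mulr_suml mulr_sumr; apply: eq_bigr => st _.
rewrite big_split /= [RHS]mulrCA; congr (_ * _).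
rewrite -[LHS]mulrA; congr (_ * _); congr (_ * _).
apply: eq_bigr => c _.
rewrite (bigD1 (st c)) //= /indic eqxx mul1r big1 ?addr0 // => k.
by move=> /negPf ->; rewrite mul0r.
Qed.

Lemma eq_bordered w w' R R' : (forall c k, w c k = w' c k) ->
  bordered w R R' = bordered w' R R'.
Proof.
move=> ww'; congr col_mx; apply/matrixP => i j; rewrite !mxE.
by apply: eq_bigr => k _; rewrite ww'.
Qed.

End Ring.

Lemma map_bordered (F F' : comNzRingType) (f : {rmorphism F -> F'}) w R R' :
  map_mx f (bordered w R R') = bordered (fun c k => f (w c k)) R R'.
Proof.
rewrite /bordered map_col_mx; congr col_mx; apply/matrixP => i j; rewrite !mxE.
  by rewrite rmorph_sum; apply: eq_bigr => k _; rewrite rmorphM rmorph_nat.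
by rewrite rmorph_nat.
Qed.

(** For a state and distinct regions this is the sign of a permutation matrix; for any other choice
    some column is zero. Being an integer, it serves over every ring. *)
Definition state_sign R R' st : int := \det (bordered (indic int st) R R').

Lemma det_bordered_sign (F : comNzRingType) (w : crossing D -> 'I_4 -> F) R R' :
  \det (bordered w R R') =
  \sum_(st : {ffun crossing D -> 'I_4}) (\prod_c w c (st c)) * (state_sign R R' st)%:~R.
Proof.
rewrite det_bordered; apply: eq_bigr => st _; congr (_ * _).
rewrite /state_sign -det_map_mx map_bordered; congr (\det _).
by apply: eq_bordered => c k; rewrite /indic rmorph_nat.
Qed.

Lemma state_sign0 R R' st : R \in regions D -> R' \in regions D -> R != R' ->
  ~~ is_state R R' st -> state_sign R R' st = 0.
Proof.
move=> RD R'D nRR' nst.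
have [Q QD [QR QR' Qch]] : exists2 Q, Q \in regions D &
    [/\ Q != R, Q != R' & forall c, chosen st c != Q].
  have : ~~ [forall Q in regions D, (Q != R) && (Q != R') ==> [exists c, chosen st c == Q]].
    apply: contra nst => /forallP H; apply: surj_state => // Q QD QR QR'.
    have /implyP/(_ QD) := H Q; rewrite QR QR' => /existsP[c /eqP]; by exists c.
  case/forallPn => Q; rewrite 2!negb_imply => /and3P[QD /andP[QR QR'] nex].
  exists Q => //; split=> // c; apply: contra nex => cQ.
  by apply/existsP; exists c.
have [j jQ] := reg_surj QD.
rewrite /state_sign (expand_det_col _ j) big1 // => i _.
rewrite [X in X * _](_ : _ = 0) ?mul0r // mxE; case: split => k; rewrite mxE jQ.
  rewrite big1 // => l _; rewrite /indic; case: eqP => [->|_]; last by rewrite mul0r.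
  by rewrite (negPf (Qch _)) mulr0.
by case: ifP => _; rewrite eq_sym ?(negPf QR) ?(negPf QR').
Qed.

Lemma state_sign_sqr R R' st : R \in regions D -> R' \in regions D -> R != R' ->
  is_state R R' st -> state_sign R R' st ^+ 2 = 1.
Proof.
move=> RD R'D nRR' /state_surj surj; have [inj avoid] := surj_inj RD R'D nRR' surj.
pose rho (i : 'I_(n + 2)) := match split i with
  | inl k => chosen st (enum_val k) | inr k => if k == 0 then R else R' end.
have rhoD i : rho i \in regions D.
  by rewrite /rho; case: split => k; [apply: region_in|case: ifP].
have rho_inj : injective rho.
  move=> i i'; rewrite /rho -{2}(splitK i) -{2}(splitK i').
  case: (split i) => k; case: (split i') => k' /=.
  - by move=> /inj /enum_val_inj ->.
  - have [nR nR'] := avoid (enum_val k).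
    by case: ifP => _ /eqP; rewrite ?(negPf nR) ?(negPf nR').
  - have [nR nR'] := avoid (enum_val k').
    by case: ifP => _ /esym/eqP; rewrite ?(negPf nR) ?(negPf nR').
  - have two (l : 'I_2) : l = 0 \/ l = 1.
      by case: l => -[|[|]] // ?; [left|right]; apply: val_inj.
    case: (two k) => ->; case: (two k') => -> //= /eqP.
      by rewrite (negPf nRR').
    by rewrite eq_sym (negPf nRR').
set B := bordered (indic int st) R R'.
have BE i j : B i j = (rho i == reg j)%:R.
  rewrite mxE /rho; case: split => k; rewrite mxE //.
  rewrite (bigD1 (st (enum_val k))) //= /indic eqxx mul1r big1 ?addr0 // => l.
  by move=> /negPf ->; rewrite mul0r.
rewrite /state_sign -/B expr2 -{2}det_tr -det_mulmx.
rewrite (_ : B *m B^T = 1%:M) ?det1 //; apply/matrixP => i i'.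
rewrite mxE [RHS]mxE; under eq_bigr do rewrite [B^T _ _]mxE !BE.
by rewrite (sum_reg (fun Q => (rho i == Q)%:R)) // (inj_eq rho_inj).
Qed.

End Bordered.

(** * Coherence of the signs *)

Section Coherence.

Variable D : diagram.
Hypothesis alt : alternating D.
Implicit Types (c e : crossing D) (d : dart D) (b : bool) (Q R : {set dart D}).
Implicit Types (st : {ffun crossing D -> 'I_4}) (T : {set crossing D}).

Local Notation n := #|crossing D|.

Definition corner_sign c (k : 'I_4) : int :=
  if (k == tgt_corner true c) || (k == tgt_corner false c) then 1 else -1.

Definition corner_sign_on T c (k : 'I_4) : int := if odd k == (c \in T) then corner_sign c k else 0.

Lemma corner_sum_sign (F : comNzRingType) (f : {set dart D} -> F) c :
  corner_sum (fun c k => (corner_sign c k)%:~R) f c = delta true f c + delta false f c.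
Proof.
rewrite /corner_sum sum_I4 /corner_sign /delta /tgt /src /tgt_corner /src_corner /over_out.
by case: positive; rewrite ?I4E /=; ring.
Qed.

Lemma corner_sum_sign_on (F : comNzRingType) (f : {set dart D} -> F) T c :
  corner_sum (fun c k => (corner_sign_on T c k)%:~R) f c = delta (c \in T) f c.
Proof.
rewrite /corner_sum sum_I4 /corner_sign_on /corner_sign /delta /tgt /src.
rewrite /tgt_corner /src_corner /over_out.
by case: (c \in T); case: positive; rewrite ?I4E /=; ring.
Qed.

Section Adjacent.

Variable d0 : dart D.
Let r := side true d0.
Let q := side false d0.

Let rV : r \in color D true. Proof. exact: side_color. Qed.
Let qF : q \in color D false. Proof. exact: side_color. Qed.
Let rD : r \in regions D. Proof. exact: (subsetP (color_sub _ _) _ rV). Qed.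
Let qD : q \in regions D. Proof. exact: (subsetP (color_sub _ _) _ qF). Qed.
Let nrq : r != q. Proof. exact: (color_neq alt rV qF). Qed.

(** Only choices with the parities of [st] have a nonzero weight, and a state is determined by its
    parities, that is, by its tree. *)
Lemma det_corner_sign_on st : is_state r q st ->
  \det (bordered (corner_sign_on (odd_set st)) r q) =
  (\prod_c corner_sign c (st c)) * state_sign r q st.
Proof.
move=> sst; rewrite det_bordered_sign (bigD1 st) //= [X in _ + X]big1 ?addr0 => [|st' nst].
  by rewrite intz; congr (_ * _); apply: eq_bigr => c _; rewrite /corner_sign_on inE eqxx.
have [sst'|nst'] := boolP (is_state r q st'); last by rewrite state_sign0 // mulr0.
have : odd_set st' != odd_set st.
  apply: contraNneq nst => oE.
  by rewrite -(tree_state_odd_set alt sst) -(tree_state_odd_set alt sst') oE.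
move=> oE; have [c cE] : exists c, odd (st' c) != odd (st c).
  apply/existsP; apply: contraNT oE => /existsPn H; apply/eqP/setP => c.
  by rewrite !inE; apply/eqP; rewrite -[_ == _]negbK H.
rewrite (bigD1 c) //= /corner_sign_on inE (negPf cE) !mul0r //.
Qed.

(** The product of the transpose of the first matrix with the second has a sum of squares as its
    quadratic form, the mixed terms cancelling by [delta_orth]. If it vanishes, [f] is constant on
    each colour, since [T] and its dual are connected, and zero because of the two border rows. *)
Lemma det_corner_sign_pos st : is_state r q st ->
  0 < \det (bordered corner_sign r q) * \det (bordered (corner_sign_on (odd_set st)) r q).
Proof.
move=> sst; set T := odd_set st; have tT := state_tree alt sst.
have tT' := tree_dual alt tT.
rewrite -(ltr0z rat) rmorphM /= -!(det_map_mx (intr : int -> rat)).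
rewrite !map_bordered -(det_tr (bordered _ _ _)) -det_mulmx.
set A := bordered _ r q; set B := bordered _ r q.
apply: det_gt0 => v v0; pose f := fun_of_row v^T.
have vE : v = \col_j f (reg j).
  by apply/colP => j; rewrite mxE /f fun_of_rowE mxE.
have -> : (v^T *m (A^T *m B) *m v) 0 0 =
    f r ^+ 2 + f q ^+ 2 + \sum_c (delta (c \in T) f c) ^+ 2.
  rewrite mulmxA -trmx_mul -mulmxA mxE big_split_ord /= addrC; congr (_ + _).
    rewrite !big_ord_recl big_ord0 addr0 /= ![(A *m v)^T _ _]mxE /A /B !mul_col_mx !col_mxEd.
    by rewrite vE !border_mx_mul //= !expr2.
  transitivity (\sum_c ((delta true f c + delta false f c) * delta (c \in T) f c)).
    rewrite -sum_cr; apply: eq_bigr => i _.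
    rewrite [(A *m v)^T _ _]mxE /A /B !mul_col_mx !col_mxEu vE !corner_mx_mul.
    by rewrite corner_sum_sign corner_sum_sign_on.
  transitivity (\sum_c (delta (c \in T) f c) ^+ 2 + \sum_c delta true f c * delta false f c);
    last by rewrite (delta_orth alt true) addr0.
  rewrite -big_split /=.
  by apply: eq_bigr => c _; case: (c \in T); ring.
have s0 : 0 <= \sum_c (delta (c \in T) f c) ^+ 2 by apply: sumr_ge0 => c _; apply: sqr_ge0.
rewrite lt0r addr_ge0 ?addr_ge0 ?sqr_ge0 // andbT; apply: contraNneq v0.
move=> /eqP; rewrite paddr_eq0 ?addr_ge0 ?sqr_ge0 // paddr_eq0 ?sqr_ge0 // !sqrf_eq0.
move=> /andP[/andP[/eqP fr /eqP fq]]; rewrite psumr_eq0 => [/allP fE|c _]; last exact: sqr_ge0.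
have {}fE b c : b = (c \in T) -> f (tgt b c) = f (src b c).
  move=> ->; have /implyP := fE c (mem_index_enum _).
  by rewrite sqrf_eq0 subr_eq0 => /(_ isT)/eqP.
have fb b Q Q' : conn_on (tgt b) (src b) (color D b) (if b then T else ~: T) ->
    Q' \in color D b -> f Q' = 0 -> Q \in color D b -> f Q = 0.
  move=> cb Q'b fQ' Qb; rewrite -fQ'; apply: (conn_const _ (cb _ _ Qb Q'b)) => e eb.
  by apply: fE; case: b eb {Q'b Qb cb} => [->//|]; rewrite inE => /negPf.
rewrite vE; apply/eqP/colP => j; rewrite !mxE.
have := reg_in j; rewrite (regionsU alt true) => /setUP[|].
  exact: (fb true _ r tT.1).
exact: (fb false _ q tT'.1).
Qed.

Lemma state_sign_coherent : exists2 c0 : int, c0 ^+ 2 = 1 &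
  forall st, is_state r q st -> (\prod_c corner_sign c (st c)) * state_sign r q st = c0.
Proof.
(* The sign of a determinant which does not involve the state. If it is 0 there are no states, and
   -1 is a default value. *)
exists (if 0 < \det (bordered corner_sign r q) then 1 else -1) => [|st sst].
  by case: ifP => _; rewrite ?sqrrN expr1n.
have := det_corner_sign_pos sst; rewrite det_corner_sign_on //.
set x := _ * state_sign r q st => Bx.
have : x ^+ 2 = 1.
  rewrite exprMn state_sign_sqr // mulr1 -prodrXl big1 // => c _.
  by rewrite /corner_sign; case: ifP; rewrite ?sqrrN expr1n.
move=> /eqP; rewrite sqrf_eq1; move: Bx.
case: (ltrgt0P (\det (bordered corner_sign r q))) => [B0|B0|->]; last by rewrite mul0r ltxx.
  by rewrite pmulr_rgt0 // => x0 /orP[] /eqP xE //; rewrite xE in x0.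
by rewrite nmulr_rgt0 // => x0 /orP[] /eqP xE //; rewrite xE in x0.
Qed.

(** By coherence the determinant is the state sum up to one global sign, which disappears in the
    square. *)
Lemma kauffman_det (F : fieldType) (h : F) :
  kauffman_sum r q h ^+ 2 =
  \det (bordered (fun c k => (corner_sign c k)%:~R * corner_weight h c k) r q) ^+ 2.
Proof.
have [c0 c02 coh] := state_sign_coherent.
have -> : \det (bordered (fun c k => (corner_sign c k)%:~R * corner_weight h c k) r q) =
    c0%:~R * kauffman_sum r q h.
  rewrite det_bordered_sign (bigID (is_state r q)) /= addrC big1 ?add0r => [|st nst].
    rewrite mulr_sumr; apply: eq_bigr => st sst; rewrite -(coh st sst) big_split /=.
    by rewrite rmorphM rmorph_prod /= mulrAC.
  by rewrite state_sign0 // mulr0.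
by rewrite exprMn -rmorphXn c02 mul1r.
Qed.

End Adjacent.

End Coherence.

(** * Independence of the fixed regions and symmetry *)

Lemma det_mx22 (R : comNzRingType) (A : 'M[R]_2) :
  \det A = A 0 0 * A 1 1 - A 0 1 * A 1 0.
Proof.
rewrite (expand_det_row _ 0) !big_ord_recl big_ord0 addr0 /cofactor !det_mx11 !mxE /=.
rewrite expr0 expr1 mul1r mulN1r mulrN.
by congr (_ * A _ _ - A _ _ * A _ _); apply: val_inj.
Qed.

Lemma diag_form (R : comNzRingType) m n (A : 'M[R]_(m, n)) (v : 'rV_m) j j' :
  (A^T *m diag_mx v *m A) j j' = \sum_i v 0 i * (A i j * A i j').
Proof.
rewrite -mulmxA mxE; apply: eq_bigr => i _.
by rewrite mul_diag_mx !mxE mulrCA.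
Qed.

Section Invariance.

Variable D : diagram.
Hypothesis alt : alternating D.
Implicit Types (c e : crossing D) (d : dart D) (b : bool) (Q R : {set dart D}).

Local Notation n := #|crossing D|.

Variable F : fieldType.

Definition alex (h : F) c (k : 'I_4) : F :=
  if k == upper_right c then (if positive c then h else h^-1)
  else if k == lower_left c then (if positive c then h^-1 else h)
  else -1.

(** * Alexander numbering and the kernel of the weighted matrix *)

Section Numbering.

Variable p : {set dart D} -> int.
Hypothesis pE : forall d, p (region d) - p (right_region d) = orient d.

Lemma numbering_at c :
  [/\ p (region (c, upper_left c)) = p (region (c, upper_right c)) + 1,
      p (region (c, lower_left c)) = p (region (c, upper_right c)) &
      p (region (c, lower_right c)) = p (region (c, upper_right c)) - 1].
Proof.
have := pE (c, upper_left c); have := pE (c, lower_left c); have := pE (c, upper_right c).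
rewrite /right_region /orient /is_outgoing /upper_left /lower_left /lower_right /upper_right /=.
by case: positive; rewrite !I4E /=; split; lia.
Qed.

(* These signs turn the coherent signs [corner_sign] into those of the relation
   h^e N + h^-e S - W - E between the corners of a crossing of sign e. *)
Definition theta Q : F := (-1) ^ ((p Q + (Q \in color D true)%:Z) %/ 2)%Z.

Lemma theta_sqr Q : theta Q * theta Q = 1.
Proof. by rewrite /theta -expfzMl mulrNN mulr1 exp1rz. Qed.

(** Both [p] and the colour change parity across an edge, so that the number halved in [theta]
    changes by 0, 2 or -2; a step by 2 flips the sign. *)
Lemma theta_next Q Q' : (p Q' + (Q' \in color D true)%:Z) = (p Q + (Q \in color D true)%:Z) + 2 ->
  theta Q' = - theta Q.
Proof.
rewrite /theta => ->; rewrite (_ : (_ + 2) %/ 2 = ((p Q + (Q \in color D true)%:Z) %/ 2)%Z + 1)%Z.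
  by rewrite expfzDr ?expr1z ?mulrN1 // oppr_eq0 oner_eq0.
lia.
Qed.

Lemma theta_eq Q Q' : (p Q' + (Q' \in color D true)%:Z) = (p Q + (Q \in color D true)%:Z) ->
  theta Q' = theta Q.
Proof. by rewrite /theta => ->. Qed.

Lemma corner_sign_alex h c k : (corner_sign c k)%:~R * corner_weight h c k =
  theta (region (c, upper_right c)) * theta (region (c, k)) * alex h c k.
Proof.
have [pW pS pEa] := numbering_at c.
set N := region (c, upper_right c).
have tN : theta N * theta N = 1 := theta_sqr N.
have colN : (N \in color D true) = positive c.
  by rewrite /N region_colorE // /upper_right; case: positive.
have tS : theta (region (c, lower_left c)) = theta N.
  apply: theta_eq; rewrite pS colN region_colorE // /N /lower_left /upper_right.
  by case: positive; rewrite ?I4E.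
have tW : theta (region (c, upper_left c)) = if positive c then theta N else - theta N.
  case: ifP => cp; [apply: theta_eq|apply: theta_next]; rewrite pW colN region_colorE //;
    by rewrite /N /upper_left /upper_right cp ?I4E /=; lia.
have tE : theta (region (c, lower_right c)) = if positive c then - theta N else theta N.
  case: ifP => cp; last first.
    apply: theta_eq; rewrite pEa colN region_colorE //.
    by rewrite /N /lower_right /upper_right cp ?I4E /=; lia.
  apply/eqP; rewrite -eqr_oppLR eq_sym; apply/eqP/theta_next.
  by rewrite pEa colN region_colorE // /N /lower_right /upper_right cp ?I4E /=; lia.
move: tS tW tE tN; rewrite /N.
rewrite /corner_sign /corner_weight /alex /tgt_corner /over_out.
rewrite /upper_left /lower_left /lower_right /upper_right.
case: positive; rewrite ?I4E /= => tS tW tE tN;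
  elim/I4_ind: k; rewrite /= ?tS ?tW ?tE ?mulrN ?tN; ring.
Qed.

Definition twist R R' : 'rV[F]_(n + 2) :=
  \row_i match split i with
  | inl k => theta (region (enum_val k, upper_right (enum_val k)))
  | inr k => theta (if k == 0 then R else R')
  end.

Lemma bordered_twist h R R' :
  bordered (fun c k => (corner_sign c k)%:~R * corner_weight h c k) R R' =
  diag_mx (twist R R') *m bordered (alex h) R R' *m diag_mx (\row_j theta (reg j)).
Proof.
apply/matrixP => i j; rewrite mul_mx_diag mul_diag_mx !mxE.
case: split => k; rewrite !mxE.
  rewrite mulr_sumr mulr_suml; apply: eq_bigr => l _; rewrite corner_sign_alex.
  by case: eqP => [->|_]; rewrite ?mulr0 ?mul0r // !mulr1 mulrAC.
by case: eqP => [->|_]; rewrite ?mulr0 ?mul0r // mulr1 theta_sqr.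
Qed.

Lemma det_twist h R R' :
  \det (bordered (fun c k => (corner_sign c k)%:~R * corner_weight h c k) R R') ^+ 2 =
  \det (bordered (alex h) R R') ^+ 2.
Proof.
rewrite bordered_twist !det_mulmx !det_diag !exprMn -!prodrXl.
rewrite !big1 ?mul1r ?mulr1 // => i _; rewrite mxE ?expr2 ?theta_sqr //.
by case: split => k; rewrite theta_sqr.
Qed.

Definition index_mx (h : F) : 'M[F]_(n + 2, 2) :=
  \matrix_(j, l) if l == 0 then h ^ p (reg j) else h ^ (- p (reg j)).

(** N and S have the same number, W and E the neighbouring ones; up to a factor the sum is h + 1/h -
    (h^m + h^-m). *)
Lemma alex_index h (m : int) c : h != 0 -> m = 1 \/ m = -1 ->
  corner_sum (alex h) (fun Q => h ^ (m * p Q)) c = 0.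
Proof.
move=> h0 m1; have [pW pS pEa] := numbering_at c; rewrite /corner_sum sum_I4.
move: pW pS pEa; rewrite /alex /upper_left /lower_left /lower_right /upper_right.
have mE x y : p x = p y + 1 -> h ^ (m * p x) = h ^ (m * p y) * h ^ m.
  by move=> ->; rewrite mulrDr mulr1 expfzDr.
have mE' x y : p x = p y - 1 -> h ^ (m * p x) = h ^ (m * p y) * h ^ (- m).
  by move=> ->; rewrite mulrBr mulr1 expfzDr.
have hh : h ^ m + h ^ (- m) = h + h^-1.
  by case: m1 => ->; rewrite ?opprK ?expr1z ?exprN1 // addrC.
case: positive; rewrite ?I4E /= => /mE -> -> /mE' ->.
  transitivity (h ^ (m * p (region (c, 1))) * (h + h^-1 - (h ^ m + h ^ (- m)))); first by ring.
  by rewrite hh subrr mulr0.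
transitivity (h ^ (m * p (region (c, 2%:R))) * (h + h^-1 - (h ^ m + h ^ (- m)))); first by ring.
by rewrite hh subrr mulr0.
Qed.

Lemma corner_mx_index h : h != 0 -> corner_mx (alex h) *m index_mx h = 0.
Proof.
move=> h0; apply/matrixP => i l; rewrite [RHS]mxE.
have := corner_mx_mul (alex h) (fun Q => h ^ ((if l == 0 then 1 else -1) * p Q)) i.
rewrite alex_index //; last by case: ifP; tauto.
move=> <-; rewrite !mxE; apply: eq_bigr => j _; rewrite !mxE.
by case: ifP => _; rewrite ?mul1r ?mulN1r.
Qed.

(** The numbers of adjacent regions differ by 1, so the determinant is h - 1/h up to sign, for every
    adjacent pair. *)
Lemma det_border_index h d : h != 0 ->
  \det (border_mx F (side true d) (side false d) *m index_mx h) ^+ 2 = (h - h^-1) ^+ 2.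
Proof.
move=> h0; set R := side true d; set R' := side false d.
have [RD R'D] : R \in regions D /\ R' \in regions D.
  by split; apply: (subsetP (color_sub _ _) _ (side_color _ _)).
have E i l : (border_mx F R R' *m index_mx h) i l =
    h ^ ((if l == 0 then 1 else -1) * p (if i == 0 then R else R')).
  set g := fun Q => h ^ ((if l == 0 then 1 else -1) * p Q).
  rewrite -[RHS]/(g (if i == 0 then R else R')) (fun_if g).
  rewrite -(border_mx_mul g) // !mxE; apply: eq_bigr => j _; rewrite !mxE /g.
  by case: (l == 0); rewrite ?mul1r ?mulN1r.
have [e1 pR] : exists e : bool, p R = p R' + (if e then 1 else -1).
  exists ((p R - p R') == 1); have := pE d; rewrite /R /R' /side /orient.
  by case: odd; case: is_outgoing => /= H; case: eqP; lia.
rewrite det_mx22 !E /= !mul1r !mulN1r pR opprD !expfzDr //.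
set x := h ^ p R'; have hx : h ^ (- p R') = x^-1 by rewrite /x -invr_expz.
have x0 : x != 0 by rewrite expfz_neq0.
by rewrite hx; case: (e1); rewrite ?opprK ?expr1z ?exprN1; field; rewrite x0 h0.
Qed.

Lemma det_alex_sqr h d d' : h != 0 -> h ^+ 2 != 1 ->
  \det (bordered (alex h) (side true d) (side false d)) ^+ 2 =
  \det (bordered (alex h) (side true d') (side false d')) ^+ 2.
Proof.
move=> h0 h1.
have hh : (h - h^-1) ^+ 2 != 0.
  rewrite sqrf_eq0; apply: contra h1; rewrite subr_eq0 => /eqP hV.
  by rewrite expr2 {2}hV mulfV.
have nz x : \det (border_mx F (side true x) (side false x) *m index_mx h) != 0.
  by rewrite -sqrf_eq0 det_border_index.
have := det_kernel (border_mx F (side true d) (side false d)) (corner_mx_index h0) (nz d').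
move=> /(congr1 (fun x => x ^+ 2)); rewrite !exprMn !det_border_index //.
by move/(mulIf hh).
Qed.

End Numbering.

Lemma orient_sum (f f' : {set dart D} -> F) c :
  \sum_k (orient (c, k))%:~R * (f (region (c, k)) * f' (right_region (c, k)) +
                               f (right_region (c, k)) * f' (region (c, k))) =
  let N := region (c, upper_right c) in let W := region (c, upper_left c) in
  let S := region (c, lower_left c) in let E := region (c, lower_right c) in
  (f N - f S) * (f' W + f' E) + (f' N - f' S) * (f W + f E).
Proof.
rewrite sum_I4 /orient /is_outgoing /right_region.
rewrite /upper_left /lower_left /lower_right /upper_right /=.
by case: positive; rewrite !I4E /=; ring.
Qed.

Lemma orient_sum_diag (g : {set dart D} -> F) c :
  \sum_k (orient (c, k))%:~R * (g (region (c, k)) + g (right_region (c, k))) =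
  2%:R * (g (region (c, upper_right c)) - g (region (c, lower_left c))).
Proof.
rewrite sum_I4 /orient /is_outgoing /right_region.
rewrite /upper_left /lower_left /lower_right /upper_right /=.
by case: positive; rewrite !I4E /=; ring.
Qed.

Definition csign c : F := if positive c then 1 else -1.

Lemma corner_sum_alex h (f : {set dart D} -> F) c :
  corner_sum (alex h) f c =
  (if positive c then h else h^-1) * f (region (c, upper_right c)) +
  (if positive c then h^-1 else h) * f (region (c, lower_left c)) -
  f (region (c, upper_left c)) - f (region (c, lower_right c)).
Proof.
rewrite /corner_sum sum_I4 /alex /upper_left /lower_left /lower_right /upper_right.
by case: positive; rewrite ?I4E /=; ring.
Qed.

Hypothesis F2 : (2%:R : F) != 0.

(** Twice the difference of the two sides is a sum over half-edges of [orient d] times an expression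
    symmetric in the two adjacent regions; it vanishes by [sum_antisym]. *)
Lemma alex_form_sym h (f f' : {set dart D} -> F) : h != 0 ->
  \sum_c csign c * (corner_sum (alex h) f c * corner_sum (alex h) f' c) =
  \sum_c csign c * (corner_sum (alex h^-1) f c * corner_sum (alex h^-1) f' c).
Proof.
move=> h0; apply/eqP; rewrite -subr_eq0 -sumrB; apply/eqP/(mulfI F2); rewrite mulr0.
pose g Q := f Q * f' Q.
pose al d : F := (orient d)%:~R * ((h ^+ 2 - h^-1 ^+ 2) * (g (region d) + g (right_region d)) -
   2%:R * (h - h^-1) * (f (region d) * f' (right_region d) + f (right_region d) * f' (region d))).
transitivity (\sum_d al d); last first.
  apply: sum_antisym => d; rewrite /al orient_mate left_mate right_mate rmorphN mulNr.
  by congr (- (_ * (_ * _ - _ * _))); rewrite addrC.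
rewrite mulr_sumr sum_crossing_dart; apply: eq_bigr => c _.
transitivity ((h ^+ 2 - h^-1 ^+ 2) *
    (2%:R * (g (region (c, upper_right c)) - g (region (c, lower_left c)))) -
  2%:R * (h - h^-1) *
   \sum_k (orient (c, k))%:~R * (f (region (c, k)) * f' (right_region (c, k)) +
                               f (right_region (c, k)) * f' (region (c, k)))).
  rewrite orient_sum !corner_sum_alex /csign /g invrK /=.
  by case: positive; ring.
rewrite -orient_sum_diag !mulr_sumr -sumrB; apply: eq_bigr => k _; rewrite /al.
ring.
Qed.

(** The invariant form and the border, which does not involve h, make up M^T E M, where E consists
    of the crossing signs and 1 on the border. Its determinant is det E times the square of det
    M. *)
Lemma det_alex_inv h R R' : h != 0 ->
  \det (bordered (alex h) R R') ^+ 2 = \det (bordered (alex h^-1) R R') ^+ 2.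
Proof.
move=> h0; pose E : 'M[F]_(n + 2) := 
  diag_mx (\row_i if split i is inl k then csign (enum_val k) else 1).
have dE : \det E != 0.
  rewrite det_diag prodf_seq_neq0; apply/allP => i _; rewrite mxE /=.
  by case: split => k; rewrite ?oner_eq0 // /csign; case: ifP; rewrite ?oppr_eq0 oner_eq0.
have form x : (bordered (alex x) R R')^T *m E *m bordered (alex x) R R' =
   \matrix_(j, j') (\sum_c csign c * (corner_sum (alex x) (fun Q => (Q == reg j)%:R) c *
         corner_sum (alex x) (fun Q => (Q == reg j')%:R) c)) +
   (border_mx F R R')^T *m border_mx F R R'.
  apply/matrixP => j j'; rewrite /E diag_form big_split_ord /= [RHS]mxE; congr (_ + _).
    rewrite [RHS]mxE -sum_cr; apply: eq_bigr => i _.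
    rewrite [_ 0 _]mxE (unsplitK (inl i)) !col_mxEu !mxE; by [].
  rewrite [RHS]mxE; apply: eq_bigr => i _.
  by rewrite [_ 0 _]mxE (unsplitK (inr i)) mul1r !col_mxEd [_^T _ _]mxE.
have : (bordered (alex h) R R')^T *m E *m bordered (alex h) R R' =
       (bordered (alex h^-1) R R')^T *m E *m bordered (alex h^-1) R R'.
  rewrite !form; congr (_ + _); apply/matrixP => j j'; rewrite !mxE.
  exact: alex_form_sym.
move=> /(congr1 determinant); rewrite !det_mulmx !det_tr !(mulrAC _ (\det E)).
by move=> /(mulIf dE); rewrite !expr2.
Qed.

End Invariance.

(** * Signature *)

(** The rows of [W] indexed by [I0] are independent modulo [K]. With eigenvectors as rows this
    bounds the number of eigenvalues of one sign. *)
Lemma card_add_rank_le (F : fieldType) m n p q (W : 'M[F]_(m, n)) (K : 'M[F]_(p, n))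
    (Z : 'M[F]_(q, n)) (I0 : {set 'I_m}) :
  (W <= Z)%MS -> (K <= Z)%MS ->
  (forall u : 'rV_m, (forall i, i \notin I0 -> u 0 i = 0) -> (u *m W <= K)%MS -> u = 0) ->
  (#|I0| + \rank K <= \rank Z)%N.
Proof.
move=> WZ KZ inj.
have WK : (#|I0| <= \rank (W *m cokermx K))%N.
  by apply: card_le_rank => u u0; rewrite mulmxA => /eqP; rewrite -submxE; apply: inj.
rewrite -(mxrank_mul_ker Z (cokermx K)) leq_add //.
  by apply: leq_trans WK _; apply/mxrankS/submxMr.
by apply: mxrankS; rewrite sub_capmx KZ; apply/sub_kermxP; rewrite mulmx_coker.
Qed.

Lemma rank_le_card (F : fieldType) m n (A : 'M[F]_(m, n)) (I0 : {set 'I_m}) :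
  (forall i, i \notin I0 -> row i A = 0) -> (\rank A <= #|I0|)%N.
Proof.
move=> A0; pose f := @enum_val _ (mem I0).
have /mxrankS/leq_trans : (A <= rowsub f A)%MS.
  apply/row_subP => i; have [iI|/A0 ->] := boolP (i \in I0); last exact: sub0mx.
  have -> : row i A = row (enum_rank_in iI i) (rowsub f A).
    by apply/rowP => j; rewrite !mxE /f enum_rankK_in.
  exact: row_sub.
by apply; apply: rank_leq_row.
Qed.

Definition indic_mx (F : fieldType) n (I0 : {set 'I_n}) : 'M[F]_n :=
  diag_mx (\row_i (i \in I0)%:R).

Lemma mul_indic_mx (F : fieldType) m n (I0 : {set 'I_n}) (A : 'M[F]_(m, n)) i j :
  (A *m indic_mx F I0) i j = if j \in I0 then A i j else 0.
Proof. by rewrite mul_mx_diag !mxE; case: ifP; rewrite ?mulr1 ?mulr0. Qed.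

Lemma indic_mx_idem (F : fieldType) n (I0 : {set 'I_n}) :
  indic_mx F I0 *m indic_mx F I0 = indic_mx F I0.
Proof.
by apply/matrixP => i j; rewrite mul_indic_mx; case: ifP => // nj; rewrite !mxE;
  case: eqP => [->|_]; rewrite ?nj ?mul0rn.
Qed.

Lemma rank_indic_mx (F : fieldType) n (I0 : {set 'I_n}) : \rank (indic_mx F I0) = #|I0|.
Proof.
apply/eqP; rewrite eqn_leq rank_le_card => [|i /negPf iI]; last first.
  by apply/rowP => j; rewrite !mxE iI mul0rn.
apply: card_le_rank => u u0 uI; apply/rowP => i; rewrite mxE.
have [iI|/u0//] := boolP (i \in I0).
by have /rowP/(_ i) := uI; rewrite mul_indic_mx iI mxE.
Qed.

Section Spectral.

Local Open Scope sesquilinear_scope.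

Variables (m : nat) (S : 'M[algC]_m).
Hypothesis S_herm : S \is hermsymmx.

Let U := spectralmx S.
Let ev := spectral_diag S.

Lemma spectralE : S = invmx U *m diag_mx ev *m U.
Proof. by apply/orthomx_spectralP/hermitian_normalmx. Qed.

Lemma spectral_quad (u : 'rV[algC]_m) :
  (u *m U *m S *m (u *m U)^t*) 0 0 = \sum_i ev 0 i * `|u 0 i| ^+ 2.
Proof.
have uU : U \is unitarymx := spectral_unitarymx S.
rewrite {1}spectralE !mulmxA mulmxK ?spectral_unit //.
rewrite trmx_mul map_mxM mulmxA -(invmx_unitary uU) mulmxK ?spectral_unit //.
rewrite mxE; apply: eq_bigr => i _; rewrite mul_mx_diag !mxE.
by rewrite normCK mulrAC mulrC mulrA.
Qed.

Lemma spectral_rank :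
  (\rank S <= #|[set i | 0 < ev 0 i]%R| + #|[set i | ev 0 i < 0]%R|)%N.
Proof.
rewrite spectralE mxrankMfree ?row_free_unit ?spectral_unit //.
apply: leq_trans (mxrankM_maxr _ _) _.
apply: (@leq_trans #|[set i | 0 < ev 0 i]%R :|: [set i | ev 0 i < 0]%R|); last first.
  by rewrite cardsU leq_subr.
apply: rank_le_card => i; rewrite !inE negb_or => /andP[ev_pos ev_neg].
have evr : ev 0 i \is Num.real.
  by have /mxOverP := hermitian_spectral_diag_real S_herm; apply.
have evi : ev 0 i = 0.
  by apply/eqP; move: ev_pos ev_neg; case: (real_ltgt0P evr).
by apply/rowP => j; rewrite !mxE evi mul0rn.
Qed.

End Spectral.

(** * The symmetrized Seifert form in terms of flows *)

Section SeifertForm.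

Variable D : diagram.
Hypothesis alt : alternating D.
Implicit Types (c : crossing D) (d : dart D) (a : dart D -> int) (b : crossing D -> int).

Local Notation n := #|crossing D|.

(** The flow leaving the crossing through [d]; unlike [a], it is antisymmetric along edges. *)
Definition flow a d : int := orient d * a d.

Lemma flow_mate a b d : is_cycle a b -> flow a (mate d) = - flow a d.
Proof. by case=> am _; rewrite /flow am orient_mate mulNr. Qed.

Lemma flow_sum a b c : is_cycle a b -> \sum_k flow a (c, k) = 0.
Proof.
case=> _ /(_ c); rewrite sum_I4 /flow /orient /is_outgoing.
rewrite /upper_left /lower_left /lower_right /upper_right /=.
by case: positive; rewrite !I4E /= => -[-> <-]; ring.
Qed.

(** The band flow is what the right strand gains, or the left strand loses; the jump computes the
    former at a positive and the latter at a negative crossing. *)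
Lemma flow_band a b c : is_cycle a b -> b c = jump (flow a) (positive c) c.
Proof.
case=> _ /(_ c); rewrite /jump /flow /orient /is_outgoing /over_out.
rewrite /upper_left /lower_left /lower_right /upper_right /=.
by case: positive; rewrite !I4E /= => -[e1 e2]; rewrite ?e1 -?e2; ring.
Qed.

Lemma jump_map (F : comNzRingType) (al : dart D -> int) (b : bool) c :
  (jump al b c)%:~R = jump (fun d => (al d)%:~R) b c :> F.
Proof. by rewrite /jump; case: b; rewrite ?rmorphN rmorphD. Qed.

Lemma jump_jump_orth a b a' b' e : is_cycle a b -> is_cycle a' b' ->
  \sum_c jump (flow a) e c * jump (flow a') (~~ e) c = 0.
Proof.
move=> cy cy'; apply: (@intr_inj rat).
pose al d : rat := (flow a d)%:~R; pose al' d : rat := (flow a' d)%:~R.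
have [alm alm'] : (forall d, al (mate d) = - al d) /\ (forall d, al' (mate d) = - al' d).
  by split=> d; rewrite /al /al' (flow_mate _ cy, flow_mate _ cy') rmorphN.
have [als als'] : (forall c, \sum_k al (c, k) = 0) /\ (forall c, \sum_k al' (c, k) = 0).
  by split=> c; rewrite /al /al' -rmorph_sum (flow_sum _ cy, flow_sum _ cy').
have [f fE] := jump_delta alt alm' als' (~~ e).
rewrite rmorph_sum -[RHS](jump_orth alt alm als e f); apply: eq_bigr => c _.
by rewrite rmorphM /= !jump_map -/al' fE.
Qed.

(** After doubling, the summands agree crossing by crossing up to three terms whose sums vanish: two
    by orthogonality of X and Y, the third by cancellation along edges. *)
Lemma seifert_sym a b a' b' : is_cycle a b -> is_cycle a' b' ->
  let X := jump (flow a) true in let Y := jump (flow a) false in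
  let X' := jump (flow a') true in let Y' := jump (flow a') false in
  seifert_form a b' + seifert_form a' b =
  \sum_c ((if positive c then 0 else (X c - Y c) * (X' c - Y' c)) - X c * X' c).
Proof.
move=> cy cy' X Y X' Y'; apply: (@mulfI _ 2%:Z) => //.
have o1 := jump_jump_orth true cy cy'; have o2 := jump_jump_orth true cy' cy.
have : \sum_d orient d * (a d * a' d) = 0.
  by apply: sum_antisym => d; rewrite orient_mate cy.1 cy'.1 mulNr.
rewrite sum_crossing_dart => o3.
rewrite /seifert_form -opprD -big_split /= -sumrN.
transitivity (\sum_c (2%:Z * ((if positive c then 0 else (X c - Y c) * (X' c - Y' c)) - X c * X' c)
  + (X c * Y' c + X' c * Y c + \sum_k orient (c, k) * (a (c, k) * a' (c, k))))).
  rewrite mulr_sumr; apply: eq_bigr => c _.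
  have := cy.2 c; have := cy'.2 c; rewrite sum_I4 /X /Y /X' /Y' /jump /flow.
  rewrite /orient /is_outgoing /over_out /upper_left /lower_left /lower_right /upper_right /=.
  by case: positive; rewrite !I4E /= => -[-> <-] [-> <-]; ring.
rewrite big_split /= -mulr_sumr [X in _ + X]big_split /= o3.
by rewrite [X in _ + (X + _)]big_split /= o1 o2 !addr0.
Qed.

Lemma is_cycle_grad (f : {set dart D} -> int) :
  is_cycle (fun d => orient d * grad f d) (fun c => delta (positive c) f c).
Proof.
split=> [d|c]; first by rewrite orient_mate grad_mate mulrNN.
rewrite /delta /grad /right_region /tgt /src /tgt_corner /src_corner /orient /is_outgoing.
rewrite /over_out /upper_left /lower_left /lower_right /upper_right /=.
by case: positive; rewrite !I4E /=; split; ring.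
Qed.

End SeifertForm.

Section ConjugateTranspose.

Local Open Scope sesquilinear_scope.

Lemma mul_trC_ge0 p (u : 'rV[algC]_p) : 0 <= (u *m u^t*) 0 0.
Proof.
rewrite mxE; apply: sumr_ge0 => i _; rewrite !mxE.
exact: mul_conjC_ge0.
Qed.

Lemma mul_trC_eq0 p (u : 'rV[algC]_p) : (u *m u^t*) 0 0 = 0 -> u = 0.
Proof.
rewrite mxE => /eqP; rewrite psumr_eq0 => [/allP u0|i _]; last first.
  by rewrite !mxE; apply: mul_conjC_ge0.
apply/rowP => i; have := u0 i (mem_index_enum _).
by rewrite !mxE mul_conjC_eq0 => /eqP.
Qed.

Lemma mul_trCC p q s (u : 'M[algC]_(p, q)) (v : 'M[algC]_(s, q)) :
  (u *m v^t*)^t* = v *m u^t*.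
Proof. by rewrite trmx_mul map_mxM trmxCK. Qed.

End ConjugateTranspose.

(** * Numbers of positive and negative eigenvalues *)

Section Signature.

Local Open Scope sesquilinear_scope.

Variable D : diagram.
Hypothesis alt : alternating D.

Local Notation n := #|crossing D|.

Variables (m : nat) (a : 'I_m -> dart D -> int) (b : 'I_m -> crossing D -> int).
Hypothesis ab_cycle : forall i, is_cycle (a i) (b i).
Hypothesis b_span : forall a' b', is_cycle a' b' ->
  exists x : 'rV[int]_m, forall c, b' c = \sum_i x 0 i * b i c.

Let S : 'M[algC]_m :=
  map_mx intr (\matrix_(i, j) (seifert_form (a i) (b j) + seifert_form (a j) (b i))).

Let flow_mx (e : bool) : 'M[algC]_(m, n) :=
  \matrix_(i, k) (jump (flow (a i)) e (enum_val k))%:~R.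

Let X := flow_mx true.
Let Y := flow_mx false.
Let neg : {set 'I_n} := [set k | ~~ positive (enum_val k)].
Let PN := indic_mx algC neg.
Let PP := indic_mx algC (~: neg).
Let A := incidence D algC true.
Let B := incidence D algC false.

Let tr_PN : PN^T = PN.
Proof. exact: tr_diag_mx. Qed.

Let PN_idem : PN *m PN = PN.
Proof. exact: indic_mx_idem. Qed.

Let PNP : PN + PP = 1%:M.
Proof.
by apply/matrixP => i j; rewrite !mxE !inE; case: eqP => [->|_];
  case: positive; rewrite /= ?addr0 ?add0r.
Qed.

Let S_form : S = (X - Y) *m PN *m (X - Y)^T - X *m X^T.
Proof.
apply/matrixP => i j; rewrite mxE [in LHS]mxE (seifert_sym alt) // rmorph_sum -sum_cr /=.
rewrite [RHS]mxE [X in _ = X + _]mxE [X in _ = _ + X]mxE [X in _ = _ - X]mxE -sumrB.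
apply: eq_bigr => k _; rewrite mul_indic_mx !mxE !inE.
by case: positive; rewrite /= rmorphB rmorphM ?rmorph0 ?mul0r // rmorphM !rmorphB.
Qed.

Let trC_flow e : (flow_mx e)^t* = (flow_mx e)^T.
Proof. by apply/matrixP => i j; rewrite !mxE conj_intr. Qed.

Let trC_incidence e : (incidence D algC e)^t* = (incidence D algC e)^T.
Proof. by apply/matrixP => i j; rewrite !mxE rmorphB !rmorph_nat. Qed.

Let trC_PN : PN^t* = PN.
Proof.
apply/matrixP => i j; rewrite !mxE eq_sym; case: eqP => [->|_]; last by rewrite mulr0n conjC0.
by rewrite rmorph_nat.
Qed.

Let orthC e p q (u : 'M[algC]_(p, n)) (v : 'M[algC]_(q, n)) :
  (u <= incidence D algC e)%MS -> (v <= incidence D algC (~~ e))%MS -> u *m v^t* = 0.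
Proof.
move=> /submxP[x ->] /submxP[y ->]; rewrite trmx_mul map_mxM trC_incidence.
by rewrite mulmxA -(mulmxA x) (incidence_orth alt) mulmx0 mul0mx.
Qed.

Let orthT e p q (u : 'M[algC]_(p, n)) (v : 'M[algC]_(q, n)) :
  (u <= incidence D algC e)%MS -> (v <= incidence D algC (~~ e))%MS -> u *m v^T = 0.
Proof.
move=> /submxP[x ->] /submxP[y ->]; rewrite trmx_mul.
by rewrite mulmxA -(mulmxA x) (incidence_orth alt) mulmx0 mul0mx.
Qed.

Let S_herm : S \is hermsymmx.
Proof.
apply/is_hermitianmxP; rewrite expr0 scale1r; apply/matrixP => i j.
by rewrite !mxE conj_intr addrC.
Qed.

Let quad (x : 'rV[algC]_m) :
  x *m S *m x^t* = (x *m (X - Y) *m PN) *m (x *m (X - Y) *m PN)^t* - (x *m X) *m (x *m X)^t*.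
Proof.
have XYT : (X - Y)^t* = (X - Y)^T by rewrite !raddfB /= !trC_flow.
rewrite S_form mulmxBr mulmxBl !trmx_mul !map_mxM trC_PN XYT trC_flow.
rewrite !mulmxA; congr (_ *m _ *m _ - _).
by rewrite -[in LHS]PN_idem !mulmxA.
Qed.

Let flow_mx_sub e : (flow_mx e <= incidence D algC e)%MS.
Proof.
apply/row_subP => i; rewrite (incidence_exact alt); apply/sub_kermxP.
have -> : row i (flow_mx e) = \row_k jump (fun d => (flow (a i) d)%:~R) e (enum_val k).
  by apply/rowP => k; rewrite !mxE jump_map.
apply: jump_incidence => // [d|c].
  by rewrite (flow_mate _ (ab_cycle i)) rmorphN.
by rewrite -rmorph_sum (flow_sum _ (ab_cycle i)).
Qed.

Let subA (x : 'rV[algC]_m) : (x *m X <= A)%MS.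
Proof. exact: submx_trans (submxMl _ _) (flow_mx_sub true). Qed.

Let subB (x : 'rV[algC]_m) : (x *m Y <= B)%MS.
Proof. exact: submx_trans (submxMl _ _) (flow_mx_sub false). Qed.

(** The differences along the edges of the Tait graph that are supported on the negative edges. *)
Let K := (A :&: PN)%MS.

Let PN_fix p (u : 'M[algC]_(p, n)) : (u <= PN)%MS -> u *m PN = u.
Proof. by move=> /submxP[x ->]; rewrite -mulmxA PN_idem. Qed.

(* On a vector whose second component z lies in K the form is -|X - z|^2. *)
Let card_pos : (#|[set i | 0 < spectral_diag S 0 i]%R| + \rank K <= #|neg|)%N.
Proof.
rewrite -(rank_indic_mx algC neg).
apply: (card_add_rank_le (W := spectralmx S *m (X - Y) *m PN) (K := K));
  rewrite ?submxMl ?capmxSr //.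
move=> u u0; rewrite !mulmxA; set x := u *m spectralmx S; set z := x *m _ *m PN => zK.
have zA : (z <= A)%MS := submx_trans zK (capmxSl _ _).
(* [z] is supported on the negative edges and lies in the row space of [A], hence is orthogonal to
   [x *m Y]. *)
have zz : z *m z^t* = z *m (x *m X)^t*.
  have zPN : z *m PN = z by rewrite /z -mulmxA PN_idem.
  rewrite {2}/z [in LHS]trmx_mul map_mxM trC_PN mulmxA zPN mulmxBr raddfB /= raddfB /= mulmxBr.
  by rewrite (orthC (e := true) zA (subB x)) subr0.
have quadE : x *m S *m x^t* = - ((x *m X - z) *m (x *m X - z)^t*).
  have zz' : x *m X *m z^t* = z *m z^t*.
    by have := congr1 (fun M => M^t*) zz; rewrite /= (mul_trCC z z) (mul_trCC z (x *m X)) => ->.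
  rewrite quad -/z raddfB /= raddfB /= mulmxBr !mulmxBl zz' -zz.
  by rewrite subrr subr0 opprB.
have sumE : \sum_i spectral_diag S 0 i * `|u 0 i| ^+ 2 <= 0.
  by rewrite -(spectral_quad S_herm) -/x quadE [X in X <= _]mxE oppr_le0 mul_trC_ge0.
have ev0 i : 0 <= spectral_diag S 0 i * `|u 0 i| ^+ 2.
  have [|/u0 ->] := boolP (i \in [set i | 0 < spectral_diag S 0 i]).
    by rewrite inE => /ltW ei; rewrite mulr_ge0 // exprn_ge0.
  by rewrite normr0 expr0n mulr0.
have /eqP : \sum_i spectral_diag S 0 i * `|u 0 i| ^+ 2 = 0.
  by apply/le_anti; rewrite sumE sumr_ge0.
rewrite psumr_eq0 => [/allP uE|//]; apply/rowP => i; rewrite mxE.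
have [|/u0 //] := boolP (i \in [set i | 0 < spectral_diag S 0 i]).
rewrite inE => /lt0r_neq0 ei; have := uE i (mem_index_enum _).
by rewrite mulf_eq0 (negPf ei) sqrf_eq0 normr_eq0 => /eqP.
Qed.

(* On a vector whose first component lies in K, so that it is supported on the
   negative edges, the form is the square of the norm of the second one. *)
Let card_neg : (#|[set i | spectral_diag S 0 i < 0]%R| + \rank K <= \rank A)%N.
Proof.
apply: (card_add_rank_le (W := spectralmx S *m X) (K := K)); rewrite ?capmxSl //.
  exact: submx_trans (submxMl _ _) (flow_mx_sub true).
move=> u u0; rewrite !mulmxA; set x := u *m spectralmx S; set w := x *m X => wK.
set v := x *m Y *m PN.
have wA : (w <= A)%MS := submx_trans wK (capmxSl _ _).
have wP : w *m PN = w := PN_fix (submx_trans wK (capmxSr _ _)).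
have wv : w *m v^t* = 0.
  by rewrite /v [in LHS]trmx_mul map_mxM trC_PN mulmxA wP (orthC (e := true) wA (subB x)).
have vw : v *m w^t* = 0 by rewrite -(mul_trCC w v) wv trmx0 map_mx0.
have quadE : x *m S *m x^t* = v *m v^t*.
  rewrite quad mulmxBr mulmxBl -/w -/v wP raddfB /= raddfB /= mulmxBr !mulmxBl wv vw.
  by rewrite subr0 sub0r opprK addrC addKr.
have sumE : 0 <= \sum_i spectral_diag S 0 i * `|u 0 i| ^+ 2.
  by rewrite -(spectral_quad S_herm) -/x quadE mul_trC_ge0.
have ev0 i : 0 <= - (spectral_diag S 0 i * `|u 0 i| ^+ 2).
  have [|/u0 ->] := boolP (i \in [set i | spectral_diag S 0 i < 0]).
    by rewrite inE oppr_ge0 => /ltW ei; rewrite mulr_le0_ge0 // exprn_ge0.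
  by rewrite normr0 expr0n mulr0 oppr0.
have /eqP : \sum_i - (spectral_diag S 0 i * `|u 0 i| ^+ 2) = 0.
  by apply/le_anti; rewrite sumr_ge0 // sumrN oppr_le0 sumE.
rewrite psumr_eq0 => [/allP uE|//]; apply/rowP => i; rewrite mxE.
have [|/u0 //] := boolP (i \in [set i | spectral_diag S 0 i < 0]).
rewrite inE => /ltr0_neq0 ei; have := uE i (mem_index_enum _).
by rewrite oppr_eq0 mulf_eq0 (negPf ei) sqrf_eq0 normr_eq0 => /eqP.
Qed.

Let PN_PP : PN *m PP = 0.
Proof.
apply/matrixP => i j; rewrite mul_indic_mx inE !mxE.
by case: eqP => [->|_]; case: (j \in neg); rewrite ?mulr0n.
Qed.

Let PP_PN : PP *m PN = 0.
Proof.
apply/matrixP => i j; rewrite mul_indic_mx !mxE !inE.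
by case: eqP => [->|_]; case: positive; rewrite ?mulr0n.
Qed.

Let band_mx := X *m PP + Y *m PN.

Let band_mxE i k : band_mx i k = (b i (enum_val k))%:~R.
Proof.
rewrite mxE !mul_indic_mx !inE !mxE (flow_band _ (ab_cycle i)).
by case: positive; rewrite /= ?addr0 ?add0r.
Qed.

(** Row [j] is the band flow of the cycle given by the gradient of the indicator function of the
    region [reg j]. *)
Let T := A *m PP + B *m PN.

Let T_sub : (T <= band_mx)%MS.
Proof.
apply/row_subP => j.
have [x xE] := b_span (is_cycle_grad (fun Q => (Q == reg j)%:R : int)).
apply/submxP; exists (map_mx intr x); apply/rowP => k.
rewrite mxE [X in X = _]mxE [X in X + _]mul_indic_mx [X in _ + X]mul_indic_mx !mxE !inE.
have := congr1 (intr : int -> algC) (xE (enum_val k)); rewrite rmorph_sum /= => sE.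
transitivity ((delta (positive (enum_val k)) (fun Q => (Q == reg j)%:R : int)
                 (enum_val k))%:~R : algC).
  by rewrite /delta rmorphB !rmorph_nat; case: positive; rewrite /= ?addr0 ?add0r.
rewrite sE; apply: eq_bigr => i _.
by rewrite rmorphM /= -band_mxE !mxE.
Qed.

(** It keeps the shaded rows, which are the nonzero ones of [A], and kills [B]; thus it separates
    the two summands of [T]. *)
Let PSh : 'M[algC]_(n + 2) := diag_mx (\row_j (reg j \in color D true)%:R).

Let PSh_incidence e : PSh *m incidence D algC e = if e then incidence D algC e else 0.
Proof.
apply/matrixP => j k; rewrite mul_diag_mx !mxE.
have notin e' c : (tgt (D := D) e' c == reg j) -> (reg j \in color D true) = e'.
  move=> /eqP <-; case: e'; first exact: tgt_color.
  by apply/negP => /(color_neq alt)/(_ (tgt_color false c)); rewrite eqxx.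
have notin' e' c : (src (D := D) e' c == reg j) -> (reg j \in color D true) = e'.
  move=> /eqP <-; case: e'; first exact: src_color.
  by apply/negP => /(color_neq alt)/(_ (src_color false c)); rewrite eqxx.
have := notin e (enum_val k); have := notin' e (enum_val k).
case: e {notin notin'}; rewrite !mxE; case: (tgt _ _ == _); case: (src _ _ == _) => //;
  move=> H1 H2; rewrite ?(H1 isT) ?(H2 isT) ?mul1r ?mul0r ?subrr ?mulr0 //.
Qed.

(** The row space of [T] is the direct sum of those of [A *m PP] and [B *m PN]. Each has a rank
    defect of dimension [K], for the second because the kernel of [B^T] is the row space of [A]. *)
Let rank_T : (\rank T + 2 * \rank K = \rank A + #|neg|)%N.
Proof.
have PT : PSh *m T = A *m PP by rewrite mulmxDr !mulmxA !PSh_incidence mul0mx addr0.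
have TE : (T :=: A *m PP + B *m PN)%MS.
  apply/eqmxP/andP; split; first by rewrite addmx_sub_adds.
  rewrite addsmx_sub -PT submxMl /=.
  have -> : B *m PN = T - PSh *m T by rewrite PT /T addrAC subrr add0r.
  by rewrite addmx_sub // eqmx_opp submxMl.
have cap0 : (A *m PP :&: B *m PN = 0)%MS.
  apply/eqP; rewrite -submx0; apply/rV_subP => v; rewrite sub_capmx.
  move=> /andP[/submxP[x ->] /submxP[y xy]].
  have : x *m (A *m PP) *m PN = 0 by rewrite -!mulmxA PP_PN !mulmx0.
  by rewrite xy -!mulmxA PN_idem => ->; rewrite sub0mx.
rewrite TE mxrank_disjoint_sum //.
have r1 := mxrank_mul_ker A PP.
have r2 := mxrank_mul_ker PN B^T; rewrite rank_indic_mx in r2.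
have k1 : (kermx PP :=: PN)%MS.
  apply/eqmxP/andP; split; last exact/sub_kermxP.
  apply/rV_subP => v /sub_kermxP vP; rewrite -[v]mulmx1 -PNP mulmxDr vP addr0.
  exact: submxMl.
have rA : \rank (A :&: kermx PP)%MS = \rank K.
  by rewrite (cap_eqmx (eqmx_refl A) k1).
have rB : \rank (PN :&: kermx B^T)%MS = \rank K.
  by rewrite capmxC (cap_eqmx (eqmx_sym (incidence_exact alt algC true)) (eqmx_refl PN)).
have : \rank (B *m PN) = \rank (PN *m B^T) by rewrite -mxrank_tr trmx_mul tr_PN.
lia.
Qed.

(** It suffices that the kernel of [S] consists of cycles with zero band flow. For such a kernel
    vector, [w] turns out to equal [z], which is supported on the negative edges; this kills both
    parts of the band flow. *)
Let rank_S : (\rank T <= \rank S)%N.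
Proof.
apply: leq_trans (mxrankS T_sub) _.
suff : (kermx S <= kermx band_mx)%MS.
  by move=> /mxrankS; rewrite !mxrank_ker leq_sub2lE // rank_leq_row.
apply/rV_subP => x /sub_kermxP xS; apply/sub_kermxP.
set w := x *m X; set v := x *m Y; set z := (w - v) *m PN.
have eq0 : z *m (X - Y)^T - w *m X^T = 0.
  by move: xS; rewrite S_form mulmxBr !mulmxA mulmxBr -/w -/v.
have [C TC] := submxP T_sub.
have [E1 E2] : (A - C *m X) *m PP = 0 /\ (B - C *m Y) *m PN = 0.
  have H : (A - C *m X) *m PP + (B - C *m Y) *m PN = 0.
    apply/eqP; rewrite !mulmxBl addrACA -opprD -!mulmxA -mulmxDr -/band_mx -TC.
    by rewrite subrr.
  split.
    have := congr1 (mulmx^~ PP) H; rewrite /= mulmxDl -!mulmxA PN_PP mulmx0 addr0 mul0mx.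
    by rewrite indic_mx_idem.
  have := congr1 (mulmx^~ PN) H; rewrite /= mulmxDl -!mulmxA PP_PN mulmx0 add0r mul0mx.
  by rewrite PN_idem.
set G := A - C *m X in E1; set H := B - C *m Y in E2.
have GA : (G <= A)%MS.
  by rewrite addmx_sub // eqmx_opp (submx_trans (submxMl _ _) (flow_mx_sub true)).
have GP : G *m PN = G by rewrite -[RHS]mulmx1 -PNP mulmxDr E1 addr0.
have zG : z *m G^T = w *m G^T.
  rewrite /z -mulmxA -tr_PN -trmx_mul GP mulmxBl.
  by rewrite -[X in _ - X]trmxK trmx_mul trmxK (orthT (e := true) GA (subB x)) trmx0 subr0.
have zH : z *m H^T = 0 by rewrite /z -mulmxA -tr_PN -trmx_mul E2 trmx0 mulmx0.
(* The relation [eq0] extends from the given cycles to all functions on regions: by [zG] and [zH]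
   the remainders [G] and [H] contribute nothing. *)
have key : z *m (A - B)^T - w *m A^T = 0.
  have -> : A = C *m X + G by rewrite /G addrC subrK.
  have -> : B = C *m Y + H by rewrite /H addrC subrK.
  have -> : C *m X + G - (C *m Y + H) = C *m (X - Y) + (G - H).
    by rewrite mulmxBr opprD addrACA.
  have -> : (C *m (X - Y) + (G - H))^T = (X - Y)^T *m C^T + (G^T - H^T).
    by rewrite [LHS]raddfD /= [(G - H)^T]raddfB /= trmx_mul.
  have -> : (C *m X + G)^T = X^T *m C^T + G^T by rewrite [LHS]raddfD /= trmx_mul.
  rewrite !mulmxDr mulmxN zG zH subr0 !mulmxA.
  by rewrite opprD addrACA subrr addr0 -mulmxBl eq0 mul0mx.
(* Restricting to the shaded regions splits the relation into one for [A] and one for [B]. *)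
have keyP := congr1 (mulmx^~ PSh) key.
have tA : A^T *m PSh = A^T by have := congr1 trmx (PSh_incidence true); rewrite trmx_mul tr_diag_mx.
have tB : B^T *m PSh = 0.
  by have := congr1 trmx (PSh_incidence false); rewrite trmx_mul tr_diag_mx trmx0.
have AB : (A - B)^T = A^T - B^T by rewrite [LHS]raddfB.
have zwA : (z - w) *m A^T = 0.
  have ABP : (A^T - B^T) *m PSh = A^T by rewrite mulmxBl tA tB subr0.
  move: keyP; rewrite /= AB mul0mx [LHS]mulmxBl -!mulmxA ABP tA => keyP.
  by rewrite [LHS]mulmxBl -!mulmxA.
have zB : z *m B^T = 0.
  move: key; rewrite AB mulmxBr addrAC -mulmxBl zwA sub0r => /eqP.
  by rewrite oppr_eq0 => /eqP.
have zwA' : (z - w <= A)%MS.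
  rewrite addmx_sub ?eqmx_opp ?subA // (incidence_exact alt algC true).
  exact/sub_kermxP.
have zw : z = w.
  apply/eqP; rewrite -subr_eq0; apply/eqP/mul_trC_eq0.
  have [y yE] := submxP zwA'.
  by rewrite {2}yE trmx_mul map_mxM trC_incidence mulmxA zwA mul0mx mxE.
have wPP : w *m PP = 0 by rewrite -zw /z -mulmxA PN_PP mulmx0.
have vPN : v *m PN = 0.
  have := zw; rewrite /z mulmxBl -[in RHS](mulmx1 w) -PNP mulmxDr wPP addr0.
  by move=> /(congr1 (fun M => w *m PN - M)); rewrite subrr opprB addrC subrK.
by rewrite /band_mx mulmxDr !mulmxA -/w -/v wPP vPN addr0.
Qed.

(** The two upper bounds add up to the rank of [T], which is at most that of [S] and so at most the
    number of nonzero eigenvalues. Hence both bounds are attained, and the rank of [K] cancels in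
    their difference. *)
Lemma signature_counts :
  (#|[set i | 0 < spectral_diag S 0 i]%R| + \rank A =
   #|[set i | spectral_diag S 0 i < 0]%R| + #|neg|)%N.
Proof.
have := card_pos; have := card_neg; have := rank_T; have := rank_S.
have := spectral_rank S_herm; lia.
Qed.

End Signature.

Lemma signatureE (D : diagram) (alt : alternating D) m (V : 'M[int]_m) :
  seifert_matrix D V ->
  signature (V + V^T) + #|color D true|%:Z = #|[set c : crossing D | ~~ positive c]|%:Z + 1.
Proof.
case=> a [b [cy span ->]].
have span' a' b' : is_cycle a' b' -> exists x : 'rV[int]_m, forall c, b' c = \sum_i x 0 i * b i c.
  by move=> /span[x [xE _]]; exists x.
have := signature_counts alt cy span'.
rewrite /signature.
have -> : \matrix_(i, j) seifert_form (a i) (b j) + (\matrix_(i, j) seifert_form (a i) (b j))^T =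
  \matrix_(i, j) (seifert_form (a i) (b j) + seifert_form (a j) (b i)).
  by apply/matrixP => i j; rewrite !mxE.
have -> : #|[set k : 'I_#|crossing D| | ~~ positive (enum_val k)]| =
    #|[set c : crossing D | ~~ positive c]|.
  rewrite -[RHS](card_imset _ (@enum_rank_inj _)); congr #|pred_of_set _|; apply/setP => k.
  rewrite inE; apply/idP/imsetP => [kn|[c + ->]]; last by rewrite inE enum_rankK.
  by exists (enum_val k); rewrite ?inE ?enum_valK.
have <- := (incidence_rank alt algC true).1 => /=.
move: (\rank _) #|[set c | ~~ _]| => r nn /(congr1 Posz); rewrite !PoszD => H.
by rewrite -(addn1 r) PoszD addrA; congr (_ + 1); rewrite addrAC H addrC addKr.
Qed.

(** * Specializations of the tree sum *)

Section TreeSums.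

Variable D : diagram.
Hypothesis alt : alternating D.
Implicit Types (d : dart D) (T : {set crossing D}) (r q : {set dart D}).

Local Notation neg := [set c : crossing D | ~~ positive c].

Lemma iota_sum r T : (iota_pos r T + iota_bar_pos r T)%N = #|T :\: neg|.
Proof.
rewrite -(cardsID [set e | int_semi_active r T e] (T :\: neg)).
by congr (_ + _)%N; apply: eq_card => e; rewrite !inE negbK; case: (e \in T); case: positive;
  rewrite /= ?andbT ?andbF.
Qed.

Lemma eps_sum q T : (eps_neg q T + eps_bar_neg q T)%N = #|neg :\: T|.
Proof.
rewrite -(cardsID [set e | ext_semi_active q T e] (neg :\: T)).
by congr (_ + _)%N; apply: eq_card => e; rewrite !inE; case: (e \in T); case: positive;
  rewrite /= ?andbT ?andbF.
Qed.

(** A spanning tree has |V| - 1 edges; its negative edges cancel. *)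
Lemma tree_counts r q T : spanning_tree T ->
  (iota_pos r T + iota_bar_pos r T + #|neg| + 1 =
   #|color D true| + (eps_neg q T + eps_bar_neg q T))%N.
Proof.
move=> /spanning_treeP tT; rewrite iota_sum eps_sum.
have [Q Qb] := color_nonempty alt true.
have := tree_card (@tgt_color D _) (@src_color D _) Qb tT.
have := cardsD1 Q (color D true); rewrite Qb.
have := cardsID neg T; have := cardsID T neg; rewrite (setIC neg T) add1n.
move: #|T :&: neg| #|T :\: neg| #|neg :\: T| #|neg| #|T| #|color D true :\ Q| #|color D true|.
lia.
Qed.

Definition tree_weight (F : fieldType) (h : F) r q T : F :=
  h ^+ iota_pos r T * (- h^-1) ^+ iota_bar_pos r T *
  h^-1 ^+ eps_neg q T * (- h) ^+ eps_bar_neg q T.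

Lemma kauffman_sum_trees (F : fieldType) (h : F) d :
  kauffman_sum (side true d) (side false d) h =
  \sum_(T | spanning_tree T) tree_weight h (side true d) (side false d) T.
Proof.
rewrite /kauffman_sum (sum_states alt); apply: eq_bigr => T _.
exact: tree_state_weight.
Qed.

Lemma kauffman_sum_tait (F : fieldType) (h : F) d :
  kauffman_sum (side true d) (side false d) h =
  tait_eval (side true d) (side false d) h^-1 (- h) h^-1 (- h).
Proof.
by rewrite kauffman_sum_trees tait_evalE; apply: eq_bigr => T _; rewrite invrK invrN.
Qed.

Lemma kauffman_sumC (F : fieldType) (h : F) (R R' : {set dart D}) :
  kauffman_sum R R' h = kauffman_sum R' R h.
Proof.
apply: eq_bigl => st; apply: eq_forallb => Q.
by rewrite [(Q != R) && _]andbC.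
Qed.

(* By [tree_counts] all terms are homogeneous of the same degree. *)
Lemma tait_eval_scale (F : fieldType) (l x y : F) r q : l != 0 ->
  tait_eval r q (l * x) (l * y) (l * x) (l * y) =
  l ^ (#|neg|%:Z + 1 - #|color D true|%:Z) * tait_eval r q x y x y.
Proof.
move=> l0; rewrite !tait_evalE mulr_sumr; apply: eq_bigr => T /(tree_counts r q) cnt.
have -> : l ^ (#|neg|%:Z + 1 - #|color D true|%:Z) =
    l^-1 ^+ iota_pos r T * l^-1 ^+ iota_bar_pos r T * l ^+ eps_neg q T * l ^+ eps_bar_neg q T.
  rewrite -!exprD -mulrA -exprD exprVn exprnN (exprnP l) -expfzDr //.
  congr (l ^ _); lia.
have comm (a b c e u v w z : F) : a * u * (b * v) * (c * w) * (e * z) =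
  a * b * c * e * (u * v * w * z) by ring.
by rewrite !invfM !exprMn comm.
Qed.

Lemma kauffman_sum_sqr (F : fieldType) (h : F) d d' : h != 0 -> h ^+ 2 != 1 ->
  kauffman_sum (side true d) (side false d) h ^+ 2 =
  kauffman_sum (side true d') (side false d') h ^+ 2.
Proof.
move=> h0 h1; have [p pE] := numbering alt.
by rewrite !(kauffman_det alt) !(det_twist alt pE) (det_alex_sqr pE d d').
Qed.

Lemma kauffman_sum_inv (F : fieldType) (h : F) d : (2%:R : F) != 0 -> h != 0 ->
  kauffman_sum (side true d) (side false d) h ^+ 2 =
  kauffman_sum (side true d) (side false d) h^-1 ^+ 2.
Proof.
move=> F2 h0; have [p pE] := numbering alt.
by rewrite !(kauffman_det alt) !(det_twist alt pE) (det_alex_inv F2).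
Qed.

Local Notation n := #|crossing D|.

(** The weight of [T] multiplied by h^n to clear denominators, so that it can be evaluated at h = i.
    The truncated subtraction is exact, because the two sets counted there are disjoint. *)
Definition tree_poly r q T : {poly algC} :=
  (-1) ^+ (iota_bar_pos r T + eps_bar_neg q T) *:
    'X^(iota_pos r T + eps_bar_neg q T + (n - (iota_bar_pos r T + eps_neg q T))).

Lemma tree_weight_monomial (F : fieldType) (h : F) r q T : h != 0 ->
  (-1) ^+ (iota_bar_pos r T + eps_bar_neg q T) *
    h ^+ (iota_pos r T + eps_bar_neg q T + (n - (iota_bar_pos r T + eps_neg q T))) =
  h ^+ n * tree_weight h r q T.
Proof.
move=> h0; have le : (iota_bar_pos r T + eps_neg q T <= n)%N.
  have := iota_sum r T; have := eps_sum q T; have := cardsID neg T; have := cardsC T.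
  have := subset_leq_card (subsetIr neg (~: T)); rewrite -setDE.
  move: #|_ :&: _| #|T :\: _| #|_ :\: T| #|T| #|~: T| n => *; lia.
rewrite /tree_weight -{2}(subnK le) [(- h^-1) ^+ _]exprNn [(- h) ^+ _]exprNn !exprVn !exprD.
have key (s s' x u v w k : F) : u != 0 -> v != 0 ->
    s * s' * (x * w * k) = k * (u * v) * (x * (s * u^-1) * v^-1 * (s' * w)).
  by move=> u0 v0; field; rewrite u0 v0.
by rewrite -key ?expf_neq0.
Qed.

(** At h = i one has h = -1/h, so semi-active and semi-passive edges have the same weight, and
    [tree_counts] fixes the total exponent. *)
Lemma tree_weight_i r q T : spanning_tree T ->
  tree_weight ('i : algC) r q T = 'i ^ (#|color D true|%:Z - 1 - #|neg|%:Z).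
Proof.
move=> /(tree_counts r q) cnt; have i0 := neq0Ci algC.
have iV : ('i : algC)^-1 = - 'i by rewrite invCi.
rewrite /tree_weight -iV iV opprK -mulrA -!exprD -iV.
rewrite exprVn exprnN (exprnP 'i) -expfzDr //; congr (_ ^ _); lia.
Qed.

Lemma t_half_neq0 : t_half != 0.
Proof. by rewrite tofrac_eq0 polyX_eq0. Qed.

Lemma t_half_sqr_neq1 : t_half ^+ 2 != 1.
Proof.
rewrite /t_half -tofracXn -tofrac1 tofrac_eq; apply/eqP => /polyP/(_ 2%N).
by rewrite coefXn coef1 /= => /eqP; rewrite oner_eq0.
Qed.

Lemma Lfield_2 : (2%:R : Lfield) != 0.
Proof.
have -> : (2%:R : Lfield) = tofrac 2%:R by rewrite rmorph_nat.
by rewrite tofrac_eq0 -polyC_natr polyC_eq0 pnatr_eq0.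
Qed.

(** The squares agree. If the sums were opposite, the sum of the two polynomials would vanish; its
    value at i is twice the number of trees times a power of i, so there would be no trees and both
    sums would be 0. *)
Lemma kauffman_sum_adj d d' :
  kauffman_sum (side true d) (side false d) t_half =
  kauffman_sum (side true d') (side false d') t_half.
Proof.
have := kauffman_sum_sqr d d' t_half_neq0 t_half_sqr_neq1.
move=> /eqP; rewrite eqf_sqr => /orP[/eqP//|].
pose Q x := \sum_(T | spanning_tree T) tree_poly (side true x) (side false x) T.
have QE x : tofrac (Q x) = t_half ^+ n * kauffman_sum (side true x) (side false x) t_half.
  rewrite kauffman_sum_trees rmorph_sum mulr_sumr; apply: eq_bigr => T _.
  rewrite -tree_weight_monomial ?t_half_neq0 // /tree_poly -mul_polyC rmorphM /=.
  by rewrite rmorphXn rmorphN1 !rmorphXn /= rmorphN1.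
have Qi x : (Q x).['i] = 'i ^+ n * 'i ^ (#|color D true|%:Z - 1 - #|neg|%:Z) *+
    #|[set T : {set crossing D} | spanning_tree T]|.
  rewrite horner_sum -sumr_const; apply: eq_big => [T|T tT]; first by rewrite inE.
  by rewrite hornerZ hornerXn tree_weight_monomial ?neq0Ci // tree_weight_i.
rewrite -subr_eq0 opprK => /eqP K0.
have {K0} : Q d + Q d' = 0.
  by apply/eqP; rewrite -tofrac_eq0 rmorphD /= !QE -mulrDr K0 mulr0.
move=> /(congr1 (fun p => p.['i])); rewrite hornerD !Qi horner0 -mulr2n => /eqP.
rewrite !mulrn_eq0 mulf_eq0 expf_eq0 expfz_eq0 (negPf (neq0Ci algC)) !andbF /= orbF.
rewrite cards_eq0 => /eqP noT.
have {}noT T : ~~ spanning_tree T by have := in_set0 T; rewrite -noT inE => ->.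
by rewrite !kauffman_sum_trees !big_pred0 // => T; apply/negbTE/noT.
Qed.

End TreeSums.

(** * The three formulas *)

Lemma eq_up_to_unit_scale (sigma : int) (s f : Lfield) : s ^+ 2 = 1 ->
  eq_up_to_unit sigma (s * (t_half ^ (- sigma) * f)) (neg_t_half ^ (- sigma) * f).
Proof.
move=> s2; pose iu : Lfield := tofrac ('i%:P).
have iu2 : iu ^+ 2 = -1 by rewrite /iu -rmorphXn /= -polyC_exp sqrCi !rmorphN1.
have iu0 : iu != 0 by rewrite -sqrf_eq0 iu2 oppr_eq0 oner_eq0.
have -> : neg_t_half = iu * t_half by [].
(* The factor [iu ^ sigma] compensates for [iu ^ (- sigma)] in [neg_t_half ^ (- sigma)], and its
   square is the required power of -1. *)
exists (s * iu ^ sigma).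
  by rewrite exprMn s2 mul1r exprnP exprzAC -exprnP iu2.
have iuK : iu ^ sigma * iu ^ (- sigma) = 1 by rewrite -expfzDr // subrr.
by rewrite expfzMl -[RHS]mulrA [X in _ = s * X]mulrA [X in _ = s * (X * _)]mulrA iuK mul1r.
Qed.

Lemma sign_expz_sqr (F : fieldType) (z : int) : ((-1 : F) ^ z) ^+ 2 = 1.
Proof. by rewrite exprnP exprzAC -exprnP sqrrN expr1n exp1rz. Qed.

Theorem proposition4p4
  (D : diagram) (D_alternating : alternating D)
  (* the two regions fixed in Kauffman's state sum *)
  (R R' : {set dart D}) (R_region : R \in regions D) (R'_region : R' \in regions D)
  (RR' : share_edge R R')
  (m : nat) (V : 'M[int]_m) (V_seifert : seifert_matrix D V)
  (* the root, and the face containing the basepoint *)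
  (r q : {set dart D}) (r_vertex : r \in shaded D) (q_face : q \in unshaded D)
  (rq : share_edge r q) :
  let Delta := kauffman_sum R R' t_half in
  let sigma := signature (V + V^T) in
  let P := @tait_eval D Lfield r q in
  [/\ eq_up_to_unit sigma Delta
        (neg_t_half ^ (- sigma) * P (- t) 1 (- t) 1),
      eq_up_to_unit sigma Delta
        (neg_t_half ^ (- sigma) * P 1 (- t) 1 (- t))
    & Delta = P t_half^-1 (- t_half) t_half^-1 (- t_half)].
Proof.
move=> Delta sigma P.
have [d0 [rE qE]] : exists d0 : dart D, r = side true d0 /\ q = side false d0.
  have [d0 [[rE qE]|[rE _]]] := share_edgeP rq; first by exists d0.
  have rF : r \in color D false by rewrite rE side_color.
  have rV : r \in color D true by rewrite color_true.
  by have := color_neq D_alternating rV rF; rewrite eqxx.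
have [d Delta_d] : exists d : dart D, Delta = kauffman_sum (side true d) (side false d) t_half.
  rewrite /Delta; have [d [[-> ->]|[-> ->]]] := share_edgeP RR'; exists d => //.
  exact: kauffman_sumC.
have DeltaE : Delta = kauffman_sum r q t_half.
  by rewrite Delta_d rE qE; apply: kauffman_sum_adj.
have h0 := t_half_neq0; have th : t = t_half ^+ 2 by [].
have sE : #|[set c : crossing D | ~~ positive c]|%:Z + 1 - #|color D true|%:Z = sigma.
  by rewrite -(signatureE D_alternating V_seifert) addrK.
have scale l x y : l != 0 -> P (l * x) (l * y) (l * x) (l * y) = l ^ sigma * P x y x y.
  by move=> l0; rewrite /P tait_eval_scale // sE.
have third h : kauffman_sum r q h = P h^-1 (- h) h^-1 (- h).
  by rewrite rE qE /P rE qE; apply: kauffman_sum_tait.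
split; last by rewrite DeltaE third.
  (* Symmetry under inversion of h holds for the squares; the remaining sign [s] goes into the
     unit. *)
  have [s s2 Ds] : exists2 s : Lfield, s ^+ 2 = 1 & Delta = s * kauffman_sum r q t_half^-1.
    have := kauffman_sum_inv D_alternating d0 Lfield_2 h0.
    rewrite -rE -qE -DeltaE => /eqP; rewrite eqf_sqr => /orP[] /eqP ->.
      by exists 1; rewrite ?expr1n ?mul1r.
    by exists (-1); rewrite ?sqrrN ?expr1n ?mulN1r.
  (* Scaling the arguments -t and 1 by -1/h gives h and -1/h, as in the third formula at 1/h. *)
  have inv : kauffman_sum r q t_half^-1 = (-1) ^ sigma * t_half ^ (- sigma) * P (- t) 1 (- t) 1.
    have e1 : - t_half^-1 * - t = t_half by rewrite mulrNN th expr2 mulKf.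
    have := scale (- t_half^-1) (- t) 1; rewrite e1 mulr1 third invrK => ->.
      by rewrite -[- t_half^-1]mulN1r expfzMl exprz_inv.
    rewrite oppr_eq0 invr_eq0; exact: h0.
  rewrite Ds inv -[X in s * X]mulrA [X in eq_up_to_unit _ X]mulrA.
  by apply: eq_up_to_unit_scale; rewrite exprMn s2 sign_expz_sqr mul1r.
(* Scaling the arguments 1 and -t by 1/h gives 1/h and -h, as in the third formula at h. *)
have -> : Delta = t_half ^ (- sigma) * P 1 (- t) 1 (- t).
  have e1 : t_half^-1 * - t = - t_half by rewrite mulrN th expr2 mulKf.
  have := scale t_half^-1 1 (- t); rewrite e1 mulr1 DeltaE third => ->.
    by rewrite exprz_inv.
  rewrite invr_eq0; exact: h0.
by rewrite -[X in eq_up_to_unit _ X]mul1r; apply: eq_up_to_unit_scale; rewrite expr1n.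
Qed.
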